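(* Let $k\in\mathbb{N}^*$, $n_1,\dots,n_k\in\mathbb{N}^*$, $P=\{1,\dots,k\}$, and let $I$ be an isocone in the finite-dimensional $C^*$-algebra $A=\bigoplus_{x\in P}M_{n_x}(\mathbb{C})$. For $x\in P$ let $\pi_x:A\to M_{n_x}(\mathbb{C})$ be the projection on the $x$-th summand and $I_x=\pi_x(I)$. Then there exists a partial order on $P$ such that $I=\mathrm{Lex}_{x\in P}I_x$.
   Context: For a $C^*$-algebra $A$ with unit $1$, $\mathrm{Re}(A)$ is the set of self-adjoint elements and $\sigma(a)$ is the spectrum of $a$. $I(\mathbb{R})$ is the set of continuous non-decreasing functions $\mathbb{R}\to\mathbb{R}$. An isocone of $A$ is a subset $I\subset\mathrm{Re}(A)$ such that: (1) $x\cdot 1\in I$ for all $x\in\mathbb{R}$; (2) $b+b'\in I$ for all $b,b'\in I$; (3) $\phi(b)\in I$ for all $b\in I$ and $\phi\in I(\mathbb{R})$ (continuous functional calculus); (4) $I$ is norm-closed; (5) $\overline{I-I}=\mathrm{Re}(A)$, where $I-I=\{b-b':b,b'\in I\}$ and the bar denotes norm closure. Given a partial order $\preceq$ on $P$ (with $x\prec y$ meaning $x\preceq y$ and $x\neq y$), $$\mathrm{Lex}_{x\in P}I_x=\{a=(a_x)_{x\in P}\in A \mid a_x\in I_x\ \forall x\in P,\ \text{and}\ \forall x,y\in P,\ x\prec y\Rightarrow \max\sigma(a_x)\le\min\sigma(a_y)\}.$$ *)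

(* Defs.v *)
From HB Require Import structures.
From mathcomp Require Import all_boot all_order all_algebra.
From mathcomp Require Import all_classical all_reals.
From mathcomp Require Import topology normedtype.
From mathcomp Require Import complex.

Set Implicit Arguments.
Unset Strict Implicit.
Unset Printing Implicit Defensive.

Import Order.TTheory GRing.Theory Num.Theory.
Import numFieldNormedType.Exports.

Local Open Scope classical_set_scope.
Local Open Scope ring_scope.
Local Open Scope complex_scope.
Local Open Scope sesquilinear_scope.

Section MatrixAlgebra.
Variables (R : realType) (n : nat).
Local Notation C := R[i].
Implicit Types (a : 'M[C]_n) (v : 'cV[C]_n).

Definition spectrum a : set C := [set z | a - z%:M \notin unitmx].

(* For n > 0 and a self-adjoint, the spectrum is a nonempty finite set of real
   numbers, so that the two bounds below are attained: they are the maximum and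
   the minimum of the spectrum. *)
Definition max_spectrum a : R := sup (@complex.Re R @` spectrum a).
Definition min_spectrum a : R := inf (@complex.Re R @` spectrum a).

(* Continuous functional calculus. By the spectral theorem a self-adjoint a is
   U^-1 D U with U = spectralmx a unitary and D = diag_mx (spectral_diag a) real;
   f(a) is U^-1 f(D) U. Lemma mx_calculusE shows that the choice of the
   diagonalization is irrelevant. Junk value if a is not self-adjoint. *)
Definition mx_calculus (f : R -> R) a : 'M[C]_n :=
  invmx (spectralmx a) *m
  diag_mx (map_mx (fun z : C => (f (complex.Re z))%:C) (spectral_diag a)) *m
  spectralmx a.

Definition l2norm v : R := Num.sqrt (\sum_i Normc.normc (v i ord0) ^+ 2).

(* The C*-norm of M_n(C). *)
Definition opnorm a : R :=
  sup [set l2norm (a *m v) | v in [set v | l2norm v <= 1]].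

End MatrixAlgebra.

Lemma diag_calculus_unique (C : numClosedFieldType) (n : nat) (f : C -> C)
    (U P : 'M[C]_n) (d e : 'rV[C]_n) :
  U \in unitmx -> P \in unitmx ->
  invmx U *m diag_mx d *m U = invmx P *m diag_mx e *m P ->
  invmx U *m diag_mx (map_mx f d) *m U = invmx P *m diag_mx (map_mx f e) *m P.
Proof.
move=> UU PU E.
have [V PE] : exists V : 'M[C]_n, P = V *m U.
  by exists (P *m invmx U); rewrite mulmxKV.
have PUV : P *m invmx U = V by rewrite PE mulmxK.
have VE : V *m diag_mx d = diag_mx e *m V.
  have := congr1 (fun M => P *m M *m invmx U) E.
  by rewrite !mulmxA mulmxK// mulmxV// mul1mx PUV -mulmxA PUV.
have VE' : V *m diag_mx (map_mx f d) = diag_mx (map_mx f e) *m V.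
  apply/matrixP => i j; move/matrixP : VE => /(_ i j).
  rewrite !mul_mx_diag !mul_diag_mx !mxE.
  have [->|Vij] := eqVneq (V i j) 0; first by rewrite !mul0r !mulr0.
  by rewrite [RHS]mulrC => /(mulfI Vij) ->; rewrite mulrC.
have PV : invmx P *m V = invmx U by rewrite -PUV mulKmx.
by rewrite {2}PE !mulmxA -(mulmxA (invmx P)) -VE' mulmxA PV.
Qed.

Lemma unitary_diag_normal (C : numClosedFieldType) (n : nat)
    (U : 'M[C]_n) (d : 'rV[C]_n) :
  U \is unitarymx -> invmx U *m diag_mx d *m U \is normalmx.
Proof.
move=> Uu; apply/orthomx_spectral_subproof.
by exists (U, d).
Qed.

Lemma mx_calculusE (R : realType) (n : nat) (f : R -> R)
    (U : 'M[R[i]]_n) (d : 'rV[R]_n) :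
  U \is unitarymx ->
  mx_calculus f (invmx U *m diag_mx (map_mx (real_complex R) d) *m U) =
    invmx U *m diag_mx (map_mx (real_complex R) (map_mx f d)) *m U.
Proof.
move=> Uu; set a := _ *m U.
have /orthomx_spectralP aS : a \is normalmx by exact: unitary_diag_normal.
have dE : map_mx (real_complex R) (map_mx f d) =
    map_mx (fun z : R[i] => (f (complex.Re z))%:C) (map_mx (real_complex R) d).
  by apply/rowP => i; rewrite !mxE.
rewrite dE; symmetry; apply: diag_calculus_unique.
- exact: unitarymx_unit.
- exact: spectral_unit.
- exact: aS.
Qed.

Section DirectSum.
Variables (R : realType) (k : nat) (n : 'I_k -> nat).
Local Notation C := R[i].

(* The direct sum of the M_(n x)(C), x in P, with componentwise operations and
   the norm of an l^oo sum. *)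
Definition dsum : Type := forall x : 'I_k, 'M[C]_(n x).

Implicit Types (a b : dsum) (I : set dsum).

Definition dsum_scalar (r : R) : dsum := fun x => (r%:C)%:M.
Definition dsum_add a b : dsum := fun x => a x + b x.
Definition dsum_sub a b : dsum := fun x => a x - b x.
Definition dsum_adjoint a : dsum := fun x => (a x)^t*.
Definition dsum_norm a : R := \big[Num.max/0]_(x < k) opnorm (a x).

Definition self_adjoint : set dsum := [set a | dsum_adjoint a = a].

(* The coordinate projections are unital *-homomorphisms, hence the functional
   calculus of the direct sum is computed componentwise. *)
Definition calculus (f : R -> R) a : dsum := fun x => mx_calculus f (a x).

Definition norm_closure I : set dsum :=
  [set a | forall eps : R, 0 < eps ->
    exists2 b, I b & dsum_norm (dsum_sub a b) < eps].

Record isocone I : Prop := Isocone {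
  isocone_self_adjoint : I `<=` self_adjoint;
  isocone_scalar : forall r : R, I (dsum_scalar r);
  isocone_add : forall b b', I b -> I b' -> I (dsum_add b b');
  isocone_calculus : forall (b : dsum) (f : R -> R),
    I b -> continuous f -> {homo f : s t / s <= t} -> I (calculus f b);
  isocone_closed : norm_closure I `<=` I;
  isocone_dense :
    norm_closure [set dsum_sub b b' | b in I & b' in I] = self_adjoint
}.

Definition Lex (le : rel 'I_k) (J : forall x : 'I_k, set 'M[C]_(n x)) :
    set dsum :=
  [set a | (forall x, J x (a x)) /\
    forall x y, le x y -> x != y -> max_spectrum (a x) <= min_spectrum (a y)].

End DirectSum.

(* Main.v *)
(* Everything is reduced to the projections lying in I. On a finite spectrum a step
   function agrees with a continuous non-decreasing one, so I contains the spectral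
   projections 1_{>t}(b) and 1_{>=t}(b) of its elements b, and every b is a
   scalar plus a nonnegative combination of them. As the join of p and q is
   1_{>0}(p + q) and their meet is 1_{>=2}(p + q), these projections form a lattice.
   Put x <= y if x = y or max sigma(b_x) <= min sigma(b_y) for all b in I. The key
   point is that if x <= y fails then I contains a projection e with e_x = 1 and
   e_y = 0. By density of I - I, some b in I and t in R satisfy b <= t at one of
   x, y but not at the other, so that some projection of I vanishes at exactly one
   of x, y. An extremal projection of this kind commutes with I_x (perturb it by an
   element of I and take a spectral projection), hence is 0 or 1, again by density.
   Given these e, a projection of Lex is a finite join of finite meets of elements
   of I. *)
Require Import Defs.
From mathcomp Require Import all_boot all_order all_algebra.
From mathcomp Require Import all_classical all_reals.
From mathcomp Require Import topology normedtype.
From mathcomp Require Import complex ring lra.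

Set Implicit Arguments.
Unset Strict Implicit.
Unset Printing Implicit Defensive.

Import Order.TTheory GRing.Theory Num.Theory.
Import numFieldNormedType.Exports.

Local Open Scope classical_set_scope.
Local Open Scope ring_scope.
Local Open Scope complex_scope.
Local Open Scope sesquilinear_scope.

(** * Quadratic forms and functional calculus of diagonalized matrices *)

Lemma conj_diagM (K : numClosedFieldType) (n : nat) (U : 'M[K]_n) (d e : 'rV[K]_n) :
  U \in unitmx ->
  (invmx U *m diag_mx d *m U) *m (invmx U *m diag_mx e *m U) =
  invmx U *m diag_mx (\row_i (d 0 i * e 0 i)) *m U.
Proof.
move=> UU; rewrite !mulmxA mulmxK // -[_ *m diag_mx _ *m diag_mx _]mulmxA.
by rewrite mulmx_diag.
Qed.

Section QuadraticForm.
Variables (R : realType) (n : nat).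
Local Notation C := R[i].
Implicit Types (a b p q : 'M[C]_n) (v w : 'rV[C]_n) (d : 'rV[R]_n).

(** Vectors are rows and matrices act on the right. For self-adjoint [a] the entry is already real,
    so that [Re] only changes its type. *)
Definition qform a v : R := complex.Re ((v *m a *m v^t*) 0 0).
Definition sqnorm v : R := qform 1%:M v.

Definition unitary_diag (U : 'M[C]_n) d : 'M[C]_n :=
  invmx U *m diag_mx (map_mx (real_complex R) d) *m U.

(** For self-adjoint [a] the spectral diagonal is real and nothing is lost: these are the
    eigenvalues with multiplicity. *)
Definition eigenvalues a : 'rV[R]_n := map_mx (@complex.Re R) (spectral_diag a).

Lemma trCM m1 m2 m3 (A : 'M[C]_(m1, m2)) (B : 'M[C]_(m2, m3)) :
  (A *m B)^t* = B^t* *m A^t*.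
Proof. by rewrite trmx_mul map_mxM. Qed.

Lemma trCD m1 m2 (A B : 'M[C]_(m1, m2)) : (A + B)^t* = A^t* + B^t*.
Proof. by rewrite linearD /= map_mxD. Qed.

Lemma trCB m1 m2 (A B : 'M[C]_(m1, m2)) : (A - B)^t* = A^t* - B^t*.
Proof. by rewrite linearB /= map_mxB. Qed.

Lemma conj_real_complex (r : R) : (r%:C)^*%R = r%:C.
Proof. by rewrite conj_Creal // complex_real. Qed.

Lemma trC0 m1 m2 : (0 : 'M[C]_(m1, m2))^t* = 0.
Proof. by apply/matrixP => i j; rewrite !mxE rmorph0. Qed.

Lemma trC1 : (1%:M : 'M[C]_n)^t* = 1%:M.
Proof. by apply/matrixP => i j; rewrite !mxE eq_sym rmorph_nat. Qed.

Lemma qformD a b v : qform (a + b) v = qform a v + qform b v.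
Proof. by rewrite /qform mulmxDr mulmxDl mxE raddfD. Qed.

Lemma qformZ (r : R) a v : qform (r%:C *: a) v = r * qform a v.
Proof.
rewrite /qform -scalemxAr -scalemxAl mxE.
by case: ((v *m a *m v^t*) 0 0) => x y /=; rewrite mul0r subr0.
Qed.

Lemma qformB a b v : qform (a - b) v = qform a v - qform b v.
Proof. by rewrite /qform mulmxBr mulmxBl !mxE raddfB. Qed.

Lemma qform0 v : qform 0 v = 0.
Proof. by rewrite /qform mulmx0 mul0mx mxE. Qed.

Lemma qform_scalar (r : R) v : qform (r%:C)%:M v = r * sqnorm v.
Proof. by rewrite -scalemx1 qformZ. Qed.

Lemma normc_sqE (z : C) : complex.Re (z * z^*%R) = Normc.normc z ^+ 2.
Proof.
case: z => x y /=; rewrite sqr_sqrtr ?addr_ge0 ?sqr_ge0 //.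
by rewrite mulrN opprK !expr2.
Qed.

Lemma sqnormE v : sqnorm v = \sum_i Normc.normc (v 0 i) ^+ 2.
Proof.
rewrite /sqnorm /qform mulmx1 mxE raddf_sum; apply: eq_bigr => i _.
by rewrite /= !mxE normc_sqE.
Qed.

Lemma sqnorm_ge0 v : 0 <= sqnorm v.
Proof. by rewrite sqnormE sumr_ge0 // => i _; rewrite sqr_ge0. Qed.

Lemma sqnorm_eq0 v : (sqnorm v == 0) = (v == 0).
Proof.
rewrite sqnormE psumr_eq0; last by move=> i _; rewrite sqr_ge0.
apply/allP/eqP => [h|-> i _]; last by rewrite mxE Normc.normc0 expr0n eqxx.
apply/rowP => i; rewrite mxE; apply: Normc.eq0_normc; apply/eqP.
by have := h i (mem_index_enum i); rewrite implyTb sqrf_eq0.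
Qed.

Lemma sqnorm_gt0 v : (0 < sqnorm v) = (v != 0).
Proof. by rewrite lt_def sqnorm_eq0 sqnorm_ge0 andbT. Qed.

(** As [invmx U] is the adjoint of [U], the form is diagonal in the coordinates [v *m invmx U]. *)
Lemma qform_unitary_diag (U : 'M[C]_n) d v : U \is unitarymx ->
  qform (unitary_diag U d) v =
    \sum_i d 0 i * Normc.normc ((v *m invmx U) 0 i) ^+ 2.
Proof.
move=> Uu; rewrite /qform /unitary_diag !mulmxA -(mulmxA _ U).
have -> : U *m v^t* = (v *m invmx U)^t*.
  by rewrite trCM invmx_unitary // trmxCK.
rewrite mxE raddf_sum; apply: eq_bigr => i _.
rewrite mul_mx_diag !mxE /= -normc_sqE; set z := \sum_j _.
by case: z => x y /=; rewrite !mulr0; lra.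
Qed.

Lemma sqnorm_unitary (U : 'M[C]_n) v : U \is unitarymx ->
  sqnorm v = \sum_i Normc.normc ((v *m invmx U) 0 i) ^+ 2.
Proof.
move=> Uu; have UU := unitarymx_unit Uu.
have -> : sqnorm v = qform (unitary_diag U (const_mx 1)) v.
  rewrite /unitary_diag /sqnorm; congr qform.
  have -> : map_mx (real_complex R) (const_mx 1 : 'rV[R]_n) = const_mx 1.
    by apply/rowP => i; rewrite !mxE.
  by rewrite diag_const_mx mulmx1 mulVmx.
by rewrite qform_unitary_diag //; apply: eq_bigr => i _; rewrite mxE mul1r.
Qed.

Lemma selfadj_normal a : a^t* = a -> a \is normalmx.
Proof. by move=> h; apply/normalmxP; rewrite h. Qed.

Lemma selfadjE a : a^t* = a -> a = unitary_diag (spectralmx a) (eigenvalues a).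
Proof.
move=> h; have /orthomx_spectralP aS := selfadj_normal h.
have /mxOverP real_d : spectral_diag a \is a realmx.
  by apply: hermitian_spectral_diag_real; apply/is_hermitianmxP; rewrite expr0 scale1r.
rewrite /unitary_diag.
have -> : map_mx (real_complex R) (eigenvalues a) = spectral_diag a.
  by apply/rowP => i; rewrite !mxE RRe_real.
exact: aS.
Qed.

Lemma mx_calculus_diag (f : R -> R) a :
  mx_calculus f a = unitary_diag (spectralmx a) (map_mx f (eigenvalues a)).
Proof.
rewrite /mx_calculus /unitary_diag.
set d := map_mx _ (spectral_diag a); set e := map_mx _ (map_mx f _).
by have -> : d = e by apply/rowP => i; rewrite !mxE.
Qed.

Lemma unitary_diag_selfadj (U : 'M[C]_n) d : U \is unitarymx ->
  (unitary_diag U d)^t* = unitary_diag U d.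
Proof.
move=> Uu; rewrite /unitary_diag invmx_unitary // !trCM trmxCK mulmxA.
set e := map_mx _ d.
have -> : (diag_mx e)^t* = diag_mx e; last by [].
rewrite tr_diag_mx map_diag_mx.
have -> : map_mx (@Num.conj _) e = e; last by [].
apply/rowP => i; rewrite !mxE; exact: conj_real_complex.
Qed.

Lemma unitary_diagM (U : 'M[C]_n) d e : U \is unitarymx ->
  unitary_diag U d *m unitary_diag U e = unitary_diag U (\row_i (d 0 i * e 0 i)).
Proof.
move=> /unitarymx_unit UU; rewrite /unitary_diag.
apply: etrans (conj_diagM _ _ UU) _; congr (invmx U *m diag_mx _ *m U).
by apply/rowP => i; rewrite !mxE rmorphM.
Qed.

Lemma unitary_diagD (U : 'M[C]_n) d e :
  unitary_diag U d + unitary_diag U e = unitary_diag U (d + e).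
Proof. by rewrite /unitary_diag map_mxD linearD /= mulmxDr mulmxDl. Qed.

Lemma unitary_diagZ (U : 'M[C]_n) (r : R) d :
  r%:C *: unitary_diag U d = unitary_diag U (r *: d).
Proof. by rewrite /unitary_diag map_mxZ linearZ /= -scalemxAr -scalemxAl. Qed.

Lemma unitary_diag_const (U : 'M[C]_n) (r : R) : U \is unitarymx ->
  unitary_diag U (const_mx r) = (r%:C)%:M.
Proof.
move=> Uu; have UU := unitarymx_unit Uu; rewrite /unitary_diag.
have -> : map_mx (real_complex R) (const_mx r : 'rV[R]_n) = const_mx r%:C.
  by apply/rowP => i; rewrite !mxE.
by rewrite diag_const_mx scalar_mxC mulmxKV.
Qed.

(** This is what allows a discontinuous step function to be exchanged for a continuous one. *)
Lemma eq_mx_calculus (f g : R -> R) a :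
  (forall i, f (eigenvalues a 0 i) = g (eigenvalues a 0 i)) ->
  mx_calculus f a = mx_calculus g a.
Proof.
move=> fg; rewrite !mx_calculus_diag; congr unitary_diag.
by apply/rowP => i; rewrite [LHS]mxE [RHS]mxE fg.
Qed.

Lemma mx_calculus_id a : a^t* = a -> mx_calculus id a = a.
Proof. by move=> h; rewrite mx_calculus_diag map_mx_id // -selfadjE. Qed.

Lemma mx_calculusD (f g : R -> R) a :
  mx_calculus (fun s => f s + g s) a = mx_calculus f a + mx_calculus g a.
Proof.
rewrite !mx_calculus_diag unitary_diagD; congr unitary_diag.
by apply/rowP => i; rewrite !mxE.
Qed.

Lemma mx_calculusZ (r : R) (f : R -> R) a :
  mx_calculus (fun s => r * f s) a = r%:C *: mx_calculus f a.
Proof.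
rewrite !mx_calculus_diag unitary_diagZ; congr unitary_diag.
by apply/rowP => i; rewrite !mxE.
Qed.

Lemma mx_calculus_cst (r : R) a : mx_calculus (fun=> r) a = (r%:C)%:M.
Proof.
rewrite mx_calculus_diag -(unitary_diag_const r (spectral_unitarymx a)).
by congr unitary_diag; apply/rowP => i; rewrite !mxE.
Qed.

Lemma mx_calculus_selfadj f a : (mx_calculus f a)^t* = mx_calculus f a.
Proof. by rewrite mx_calculus_diag unitary_diag_selfadj // spectral_unitarymx. Qed.

End QuadraticForm.

(** A matrix [V] commutes with [diag_mx d] exactly when [d] agrees at [i] and [j] wherever [V i j]
    is nonzero, and then so does [map_mx f d]. *)
Lemma conj_diag_comm (K : numClosedFieldType) (n : nat) (U P : 'M[K]_n)
    (d : 'rV[K]_n) (f : K -> K) :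
  U \in unitmx ->
  P *m (invmx U *m diag_mx d *m U) = (invmx U *m diag_mx d *m U) *m P ->
  P *m (invmx U *m diag_mx (map_mx f d) *m U) =
    (invmx U *m diag_mx (map_mx f d) *m U) *m P.
Proof.
move=> UU E; pose V := U *m P *m invmx U.
have PE : P = invmx U *m V *m U by rewrite /V !mulmxA mulVmx // mul1mx mulmxKV.
have VE : V *m diag_mx d = diag_mx d *m V.
  have := congr1 (fun M => U *m M *m invmx U) E.
  rewrite /V !mulmxA => {}E; rewrite -[RHS]mulmxA.
  by rewrite mulmxK // mulmxV // mul1mx in E; rewrite E !mulmxA.
clearbody V; have VE' : V *m diag_mx (map_mx f d) = diag_mx (map_mx f d) *m V.
  apply/matrixP => i j; move/matrixP : VE => /(_ i j).
  rewrite !mul_mx_diag !mul_diag_mx !mxE.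
  have [->|Vij] := eqVneq (V i j) 0; first by rewrite !mul0r !mulr0.
  by rewrite [RHS]mulrC => /(mulfI Vij) ->; rewrite mulrC.
rewrite PE !mulmxA mulmxK // [in RHS]mulmxK //.
by rewrite -!mulmxA !(mulmxA V) VE' !mulmxA.
Qed.

Lemma conj_diag_row (K : numClosedFieldType) (n : nat) (U : 'M[K]_n)
    (d v : 'rV[K]_n) : U \in unitmx ->
  v *m (invmx U *m diag_mx d *m U) *m invmx U = v *m invmx U *m diag_mx d.
Proof. by move=> UU; rewrite !mulmxA mulmxK. Qed.

Lemma conj_diag_sub_unit (K : numClosedFieldType) (n : nat) (U : 'M[K]_n)
    (d : 'rV[K]_n) (z : K) :
  U \in unitmx ->
  (invmx U *m diag_mx d *m U - z%:M \in unitmx) = [forall i, d 0 i != z].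
Proof.
move=> UU.
have -> : invmx U *m diag_mx d *m U - z%:M =
    invmx U *m diag_mx (d - const_mx z) *m U.
  rewrite linearB /= mulmxBr mulmxBl diag_const_mx; congr (_ - _).
  by rewrite scalar_mxC mulmxKV.
rewrite !unitmx_mul unitmx_inv UU /= andbT unitmxE det_diag unitfE.
apply/prodf_neq0/forallP => h i; first by have := h i isT; rewrite !mxE subr_eq0.
by move=> _; rewrite !mxE subr_eq0; apply: h.
Qed.

(** * Spectral projections of a self-adjoint matrix *)

Section Projections.
Local Opaque mx_calculus invmx.
Variables (R : realType) (n : nat).
Local Notation C := R[i].
Implicit Types (a b p q : 'M[C]_n) (v w : 'rV[C]_n) (d : 'rV[R]_n).

(** Orthogonal projections, with range the [v] such that [v *m p = v] and kernel the [v] such that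
    [v *m p = 0]. *)
Definition is_proj p := p^t* = p /\ p *m p = p.

Lemma is_proj0 : is_proj 0.
Proof. by split; [exact: trC0 | exact: mulmx0]. Qed.

Lemma is_proj1 : is_proj 1%:M.
Proof. by split; [exact: trC1 | exact: mulmx1]. Qed.

Lemma mulmx_proj p v : is_proj p -> v *m p *m p = v *m p.
Proof. by case=> _ pp; rewrite -mulmxA pp. Qed.

Lemma mulmx_projC p v : is_proj p -> (v - v *m p) *m p = 0.
Proof. by move=> pp; rewrite mulmxBl mulmx_proj // subrr. Qed.

Lemma qform_proj p v : is_proj p -> qform p v = sqnorm (v *m p).
Proof.
move=> [ph pp]; rewrite /sqnorm /qform mulmx1 trCM ph.
by rewrite !mulmxA -[v *m p *m p]mulmxA pp.
Qed.

Lemma is_projC p : is_proj p -> is_proj (1%:M - p).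
Proof.
case=> ph pp; split; first by rewrite trCB trC1 ph.
by rewrite mulmxBl mul1mx mulmxBr mulmx1 pp subrr subr0.
Qed.

Lemma qform_projC p v : is_proj p -> sqnorm v - qform p v = sqnorm (v - v *m p).
Proof.
by move=> pP; rewrite -qformB (qform_proj _ (is_projC pP)) mulmxBr mulmx1.
Qed.

Lemma qform_proj_ge0 p v : is_proj p -> 0 <= qform p v.
Proof. by move=> pp; rewrite qform_proj // sqnorm_ge0. Qed.

Lemma qform_proj_le p v : is_proj p -> qform p v <= sqnorm v.
Proof. by move=> pp; rewrite -subr_ge0 qform_projC // sqnorm_ge0. Qed.

Lemma qform_proj0 p v : is_proj p -> qform p v <= 0 -> v *m p = 0.
Proof.
move=> pp h; apply/eqP; rewrite -sqnorm_eq0 -qform_proj // eq_le h /=.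
exact: qform_proj_ge0.
Qed.

Lemma qform_proj1 p v : is_proj p -> sqnorm v <= qform p v -> v *m p = v.
Proof.
move=> pp h; apply/esym/eqP; rewrite -subr_eq0 -sqnorm_eq0 -qform_projC //.
by rewrite subr_eq0 eq_le h qform_proj_le.
Qed.

Lemma qform_fix p v : is_proj p -> v *m p = v -> qform p v = sqnorm v.
Proof. by move=> pp vp; rewrite qform_proj // vp. Qed.

Lemma qform_ker p v : is_proj p -> v *m p = 0 -> qform p v = 0.
Proof. by move=> pp vp; rewrite qform_proj // vp; apply/eqP; rewrite sqnorm_eq0. Qed.

(** The two inclusions of ranges give [p *m q = p] and [q *m p = q]; the adjoint of the first is
    [q *m p = p]. *)
Lemma proj_eq p q : is_proj p -> is_proj q ->
  (forall v, v *m p = v -> v *m q = v) -> (forall v, v *m q = v -> v *m p = v) ->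
  p = q.
Proof.
move=> [ph pp] [qh qq] pq qp.
have E1 : p *m q = p.
  by apply/row_matrixP => i; rewrite row_mul pq // -row_mul pp.
have E2 : q *m p = q.
  by apply/row_matrixP => i; rewrite row_mul qp // -row_mul qq.
by rewrite -E2 -[LHS]ph -{1}E1 trCM ph qh.
Qed.

Lemma proj_eq_ker p q : is_proj p -> is_proj q ->
  (forall v, v *m p = 0 <-> v *m q = 0) -> p = q.
Proof.
move=> pP qP pq; suff : 1%:M - p = 1%:M - q by move/addrI/oppr_inj.
have fixC (r : 'M[C]_n) v : v *m (1%:M - r) = v <-> v *m r = 0.
  rewrite mulmxBr mulmx1; split=> [h|->]; last by rewrite subr0.
  by apply/eqP; rewrite -oppr_eq0 -(inj_eq (addrI v)) addr0; apply/eqP.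
by apply: proj_eq => [||v|v]; try exact: is_projC; rewrite !fixC => /pq.
Qed.

Definition step (c : bool) (t s : R) : R := (if c then t <= s else t < s)%:R.

(** A description of the spectral projection of [a] above [t] that mentions no eigenvectors. For
    self-adjoint [a] it holds of [mx_calculus (step c t) a] and of nothing else, which serves below
    to compute such projections. *)
Definition is_cut (c : bool) (t : R) a p :=
  [/\ is_proj p, p *m a = a *m p,
      forall v, v *m p = v -> v != 0 ->
        if c then t * sqnorm v <= qform a v else t * sqnorm v < qform a v &
      forall v, v *m p = 0 -> v != 0 ->
        if c then qform a v < t * sqnorm v else qform a v <= t * sqnorm v].

Lemma wsum_gt0 (e : 'I_n -> R) w : (forall i, w 0 i != 0 -> 0 < e i) ->
  w != 0 -> 0 < \sum_i e i * Normc.normc (w 0 i) ^+ 2.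
Proof.
move=> e0 w0; have sq i : 0 <= Normc.normc (w 0 i) ^+ 2 by exact: sqr_ge0.
have ge0 i : 0 <= e i * Normc.normc (w 0 i) ^+ 2.
  have [->|/e0 ei] := eqVneq (w 0 i) 0; last by rewrite mulr_ge0 // ltW.
  by rewrite Normc.normc0 expr0n mulr0.
rewrite lt_def sumr_ge0 // andbT psumr_eq0 //.
apply: contra w0 => /allP h; apply/eqP/rowP => i; rewrite mxE.
have := h i (mem_index_enum i); rewrite implyTb mulf_eq0 sqrf_eq0.
have [//|wi] := eqVneq (w 0 i) 0; rewrite gt_eqF ?e0 //= => /eqP.
exact: Normc.eq0_normc.
Qed.

Lemma wsum_ge0 (e : 'I_n -> R) w : (forall i, w 0 i != 0 -> 0 <= e i) ->
  0 <= \sum_i e i * Normc.normc (w 0 i) ^+ 2.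
Proof.
move=> e0; rewrite sumr_ge0 // => i _.
have [->|/e0 ei] := eqVneq (w 0 i) 0; last by rewrite mulr_ge0 // sqr_ge0.
by rewrite Normc.normc0 expr0n mulr0.
Qed.

Lemma mx_calculusM (f g : R -> R) a :
  mx_calculus f a *m mx_calculus g a = mx_calculus (fun s => f s * g s) a.
Proof.
rewrite !mx_calculus_diag (unitary_diagM _ _ (spectral_unitarymx a)).
congr (unitary_diag (spectralmx a) _); apply/rowP => i.
by rewrite [LHS]mxE [RHS]mxE !(mxE _ (fun _ => _)).
Qed.

Lemma step_proj c t a : is_proj (mx_calculus (step c t) a).
Proof.
split; first exact: mx_calculus_selfadj.
rewrite mx_calculusM; apply: eq_mx_calculus => i.
by rewrite /step -natrM mulnb andbb.
Qed.

Lemma mx_calculus_selfC (f : R -> R) a : a^t* = a ->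
  mx_calculus f a *m a = a *m mx_calculus f a.
Proof.
move=> ah.
have E : mx_calculus f a *m mx_calculus id a = mx_calculus id a *m mx_calculus f a.
  rewrite [LHS]mx_calculusM [RHS]mx_calculusM.
  by apply: eq_mx_calculus => i; rewrite mulrC.
by rewrite (mx_calculus_id ah) in E.
Qed.

(** In eigencoordinates [w], the difference [qform a v - t * sqnorm v] is the sum of the
    [(d 0 i - t) * |w i|^2]; for [v] in the range or in the kernel of [p], [w] is supported on one
    side of the cut. *)
Lemma step_cut c t a : a^t* = a -> is_cut c t a (mx_calculus (step c t) a).
Proof.
move=> ah; have Uu := spectral_unitarymx a; have UU := unitarymx_unit Uu.
set p := mx_calculus _ a; set d := eigenvalues a; set U := spectralmx a in Uu UU.
have pE : p = unitary_diag U (map_mx (step c t) d) by exact: mx_calculus_diag.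
have aE : a = unitary_diag U d by exact: selfadjE.
have formE v : qform a v - t * sqnorm v =
    \sum_i (d 0 i - t) * Normc.normc ((v *m invmx U) 0 i) ^+ 2.
  have := qform_unitary_diag d v Uu; rewrite -aE => ->.
  rewrite (sqnorm_unitary _ Uu) mulr_sumr -sumrB.
  by apply: eq_bigr => i _; rewrite mulrBl.
have w0 v : v != 0 -> v *m invmx U != 0.
  by apply: contra => /eqP h; rewrite -(mulmxKV UU v) h mul0mx.
have wE v i : (v *m p *m invmx U) 0 i = (v *m invmx U) 0 i * (step c t (d 0 i))%:C.
  rewrite pE /unitary_diag.
  apply: etrans (congr1 (fun M : 'rV[C]_n => M 0 i) (conj_diag_row _ _ UU)) _.
  rewrite mul_mx_diag mxE; congr (_ * _).
  by rewrite !mxE.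
split.
- exact: step_proj.
- exact: mx_calculus_selfC.
- move=> v vp /w0 v0.
  have st i : (v *m invmx U) 0 i != 0 -> if c then t <= d 0 i else t < d 0 i.
    apply: contraNT => h; rewrite -vp wE /step (negbTE h) mulr0n rmorph0.
    by rewrite mulr0.
  rewrite -subr_ge0 -subr_gt0 formE; move: st; case: (c) => st.
    by apply: wsum_ge0 => i /st; rewrite subr_ge0.
  by apply: (wsum_gt0 _ v0) => i /st; rewrite subr_gt0.
- move=> v vp /w0 v0.
  have st i : (v *m invmx U) 0 i != 0 -> if c then d 0 i < t else d 0 i <= t.
    move=> wi; have : (v *m p *m invmx U) 0 i = 0 by rewrite vp mul0mx mxE.
    move/eqP; rewrite wE mulf_eq0 (negbTE wi) /=.
    rewrite fmorph_eq0 /step pnatr_eq0 eqb0.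
    by case: (c); rewrite -?ltNge -?leNgt.
  rewrite -subr_ge0 -subr_gt0 -opprB formE -sumrN.
  under eq_bigr do rewrite -mulNr opprB.
  move: st; case: (c) => st.
    by apply: (wsum_gt0 _ v0) => i /st; rewrite subr_gt0.
  by apply: wsum_ge0 => i /st; rewrite subr_ge0.
Qed.

Lemma mx_calculus_comm (f : R -> R) a p : a^t* = a -> p *m a = a *m p ->
  p *m mx_calculus f a = mx_calculus f a *m p.
Proof.
move=> ah; have UU := spectral_unit a.
have /orthomx_spectralP aS := selfadj_normal ah => pa.
apply: (@conj_diag_comm _ _ (spectralmx a) p (spectral_diag a)
  (fun z : C => (f (complex.Re z))%:C) UU).
have E : invmx (spectralmx a) *m diag_mx (spectral_diag a) *m spectralmx a = a.
  exact: esym aS.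
by rewrite E.
Qed.

(** Since [p] commutes with [a], it commutes with the spectral projection [q]. Hence for [v] in the
    range of one of them, the component of [v] in the kernel of the other stays in that range; it is
    subject to two opposite estimates and must vanish. *)
Lemma cut_unique c t a p : a^t* = a -> is_cut c t a p ->
  mx_calculus (step c t) a = p.
Proof.
move=> ah [pP pa p1 p0]; have [qP qa q1 q0] := step_cut c t ah.
have pq := mx_calculus_comm (step c t) ah pa.
set q := mx_calculus _ a in qP qa q1 q0 pq *.
have contra2 v : (if c then t * sqnorm v <= qform a v else t * sqnorm v < qform a v) ->
  (if c then qform a v < t * sqnorm v else qform a v <= t * sqnorm v) -> False.
  by case: (c) => h h'; [have := lt_le_trans h' h | have := le_lt_trans h' h];
    rewrite ltxx.
apply: proj_eq => // v vE.
  have h : (v - v *m p) *m p = 0 by exact: mulmx_projC.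
  have h' : (v - v *m p) *m q = v - v *m p.
    by rewrite mulmxBl vE -mulmxA pq mulmxA vE.
  have [/eqP|n0] := eqVneq (v - v *m p) 0; first by rewrite subr_eq0 => /eqP.
  by case: (contra2 _ (q1 _ h' n0) (p0 _ h n0)).
have h : (v - v *m q) *m q = 0 by exact: mulmx_projC.
have h' : (v - v *m q) *m p = v - v *m q.
  by rewrite mulmxBl vE -mulmxA -pq mulmxA vE.
have [/eqP|n0] := eqVneq (v - v *m q) 0; first by rewrite subr_eq0 => /eqP.
by case: (contra2 _ (p1 _ h' n0) (q0 _ h n0)).
Qed.

End Projections.

(** * Joins and meets of projections; bounds of the spectrum through quadratic forms *)

Section SpectralBounds.
Variables (R : realType) (n : nat).
Local Notation C := R[i].
Implicit Types (a b p q : 'M[C]_n) (v w : 'rV[C]_n) (d : 'rV[R]_n).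
Local Opaque mx_calculus invmx.

Lemma qform_eig (r : R) a v : v *m a = r%:C *: v -> qform a v = r * sqnorm v.
Proof.
by move=> va; rewrite -qform_scalar /qform va mul_mx_scalar.
Qed.

Lemma is_proj_selfadjD p q : is_proj p -> is_proj q -> (p + q)^t* = p + q.
Proof. by move=> [ph _] [qh _]; rewrite trCD ph qh. Qed.

(** Both forms are nonnegative, so their sum is at most 0 only where both vanish. Kernels are used
    because the kernel of a join is the intersection of the kernels. *)
Lemma proj_join p q v : is_proj p -> is_proj q ->
  v *m mx_calculus (step false 0) (p + q) = 0 <-> v *m p = 0 /\ v *m q = 0.
Proof.
move=> pP qP; have sa := is_proj_selfadjD pP qP.
have [wP wC w1 w0] := step_cut false 0 sa.
set w := mx_calculus _ _ in wP wC w1 w0 *; split=> [vw|[vp vq]].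
  have [->|v0] := eqVneq v 0; first by rewrite !mul0mx.
  have := w0 v vw v0; rewrite mul0r qformD => le0.
  have p0 := qform_proj_ge0 v pP; have q0 := qform_proj_ge0 v qP.
  split; [apply: (qform_proj0 pP) | apply: (qform_proj0 qP)];
    move: le0 p0 q0; move: (qform p v) (qform q v) => x y; clear; lra.
(* Otherwise [v *m w] is a nonzero vector of the range of [w], where the form of [p + q] is
   positive, although [p + q] kills it. *)
apply/eqP; apply/negPn/negP => u0.
have := w1 (v *m w) (mulmx_proj v wP) u0; rewrite mul0r ltNge => /negP; apply.
rewrite (@qform_eig 0) ?mul0r // -mulmxA wC mulmxA mulmxDr vp vq addr0 mul0mx.
by rewrite scale0r.
Qed.

(** Both forms are at most [sqnorm v], so their sum reaches twice this value only where both are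
    maximal. *)
Lemma proj_meet p q v : is_proj p -> is_proj q ->
  v *m mx_calculus (step true 2) (p + q) = v <-> v *m p = v /\ v *m q = v.
Proof.
move=> pP qP; have sa := is_proj_selfadjD pP qP.
have [wP wC w1 w0] := step_cut true 2 sa.
set w := mx_calculus _ _ in wP wC w1 w0 *; split=> [vw|[vp vq]].
  have [->|v0] := eqVneq v 0; first by rewrite !mul0mx.
  have := w1 v vw v0; rewrite qformD => le2.
  have p0 := qform_proj_le v pP; have q0 := qform_proj_le v qP.
  split; [apply: (qform_proj1 pP) | apply: (qform_proj1 qP)];
    move: le2 p0 q0; move: (qform p v) (qform q v) (sqnorm v) => x y z; clear; lra.
apply/esym/eqP; rewrite -subr_eq0; apply/negPn/negP => u0.
have := w0 _ (mulmx_projC v wP) u0; rewrite ltNge => /negP; apply.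
rewrite (@qform_eig 2) // mulmxBl -mulmxA wC mulmxA mulmxDr vp vq mulmxDl.
by rewrite (_ : 2%:C = 2) ?rmorph_nat // scaler_nat mulrnBl !mulr2n.
Qed.

Lemma selfadj_bound a : a^t* = a ->
  exists2 T : R, 0 <= T &
    forall v, - (T * sqnorm v) <= qform a v <= T * sqnorm v.
Proof.
move=> ah; have Uu := spectral_unitarymx a.
exists (\sum_i `|eigenvalues a 0 i|); first exact: sumr_ge0.
move=> v; have := qform_unitary_diag (eigenvalues a) v Uu.
rewrite -selfadjE // => ->; rewrite (sqnorm_unitary _ Uu) -ler_norml.
apply: (le_trans (ler_norm_sum _ _ _)).
rewrite mulr_sumr; apply: ler_sum => i _; rewrite normrM.
rewrite (ger0_norm (sqr_ge0 _)) ler_wpM2r ?sqr_ge0 //.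
by rewrite (bigD1 i) //= lerDl sumr_ge0.
Qed.

Lemma spectrum_image a : a^t* = a ->
  @complex.Re R @` spectrum a = range (fun i => eigenvalues a 0 i).
Proof.
move=> ah; have UU := spectral_unit a.
have aE : invmx (spectralmx a) *m
    diag_mx (map_mx (real_complex R) (eigenvalues a)) *m spectralmx a = a.
  by rewrite [RHS](selfadjE ah).
have P z : reflect (exists i, (eigenvalues a 0 i)%:C = z) (a - z%:M \notin unitmx).
  have := conj_diag_sub_unit (map_mx (real_complex R) (eigenvalues a)) z UU.
  rewrite aE => ->; rewrite negb_forall.
  apply: (iffP fintype.existsP) => -[i iz]; exists i.
    by move: iz; rewrite negbK mxE => /eqP.
  by rewrite negbK mxE; apply/eqP.
have E z : spectrum a z <-> exists i, (eigenvalues a 0 i)%:C = z.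
  by split=> [h|h]; apply/P.
apply/seteqP; split=> [_ [z /E[i <-] <-]|_ [i _ <-]]; first by exists i.
by exists (eigenvalues a 0 i)%:C => //; apply/E; exists i.
Qed.

Lemma qform_eigenvalues a v : a^t* = a ->
  qform a v = \sum_i eigenvalues a 0 i *
    Normc.normc ((v *m invmx (spectralmx a)) 0 i) ^+ 2.
Proof.
move=> ah; have := qform_unitary_diag (eigenvalues a) v (spectral_unitarymx a).
by rewrite -(selfadjE ah).
Qed.

Lemma unit_eigenvector a i : a^t* = a ->
  exists2 v, sqnorm v = 1 & qform a v = eigenvalues a 0 i.
Proof.
move=> ah; have UU := spectral_unit a.
have de j : Normc.normc ((delta_mx 0 i : 'rV[C]_n) 0 j) ^+ 2 = (i == j)%:R :> R.
  rewrite mxE eqxx eq_sym andTb; case: eqP => _.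
    by rewrite (_ : Normc.normc _ = 1) ?expr1n //; exact: Normc.normc1.
  by rewrite (_ : Normc.normc _ = 0) ?expr0n //; exact: Normc.normc0.
have sum_delta (e : 'I_n -> R) :
    \sum_j e j * Normc.normc ((delta_mx 0 i : 'rV[C]_n) 0 j) ^+ 2 = e i.
  rewrite (bigD1 i) //= de eqxx mulr1 big1 ?addr0 // => j.
  by rewrite de eq_sym => /negPf ->; rewrite mulr0.
exists (delta_mx 0 i *m spectralmx a).
  rewrite (sqnorm_unitary _ (spectral_unitarymx a)) mulmxK //.
  by under eq_bigr do rewrite -[_ ^+ 2]mul1r; rewrite (sum_delta (fun=> 1)).
by rewrite qform_eigenvalues // mulmxK.
Qed.

Lemma eigenvalues_le a (t : R) : a^t* = a ->
  (forall i, eigenvalues a 0 i <= t) <-> (forall v, qform a v <= t * sqnorm v).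
Proof.
move=> ah; split=> [h v|h i]; last first.
  by have [v v1 <-] := unit_eigenvector i ah; rewrite (le_trans (h v)) // v1 mulr1.
rewrite qform_eigenvalues // (sqnorm_unitary _ (spectral_unitarymx a)) mulr_sumr.
by apply: ler_sum => i _; rewrite ler_wpM2r ?sqr_ge0.
Qed.

Lemma eigenvalues_ge a (t : R) : a^t* = a ->
  (forall i, t <= eigenvalues a 0 i) <-> (forall v, t * sqnorm v <= qform a v).
Proof.
move=> ah; split=> [h v|h i]; last first.
  by have [v v1 <-] := unit_eigenvector i ah; rewrite (le_trans _ (h v)) // v1 mulr1.
rewrite qform_eigenvalues // (sqnorm_unitary _ (spectral_unitarymx a)) mulr_sumr.
by apply: ler_sum => i _; rewrite ler_wpM2r ?sqr_ge0.
Qed.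

Hypothesis n_gt0 : (0 < n)%N.

(** The positive dimension makes the spectrum nonempty, so that [sup] is a true least upper bound
    rather than a default value. *)
Lemma max_spectrum_le a (t : R) : a^t* = a ->
  max_spectrum a <= t <-> forall v, qform a v <= t * sqnorm v.
Proof.
move=> ah; rewrite -eigenvalues_le // /max_spectrum spectrum_image //.
set A := range _; have A0 : A !=set0.
  by exists (eigenvalues a 0 (Ordinal n_gt0)); exists (Ordinal n_gt0).
have Aub : has_ubound A.
  exists (\sum_i `|eigenvalues a 0 i|) => _ [i _ <-].
  by rewrite (le_trans (ler_norm _)) // (bigD1 i) //= lerDl sumr_ge0.
split=> [h i|h]; last by apply: sup_le_ub => // _ [i _ <-].
by rewrite (le_trans _ h) // ub_le_sup //; exists i.
Qed.

Lemma min_spectrum_ge a (t : R) : a^t* = a ->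
  t <= min_spectrum a <-> forall v, t * sqnorm v <= qform a v.
Proof.
move=> ah; rewrite -eigenvalues_ge // /min_spectrum spectrum_image //.
set A := range _; have A0 : A !=set0.
  by exists (eigenvalues a 0 (Ordinal n_gt0)); exists (Ordinal n_gt0).
have Alb : has_lbound A.
  exists (- (\sum_i `|eigenvalues a 0 i|)) => _ [i _ <-].
  rewrite lerNl (le_trans _ (_ : `|eigenvalues a 0 i| <= _)) //.
    by rewrite -normrN ler_norm.
  by rewrite (bigD1 i) //= lerDl sumr_ge0.
split=> [h i|h]; last by apply: lb_le_inf => // _ [i _ <-].
by rewrite (le_trans h) // ge_inf //; exists i.
Qed.

End SpectralBounds.

(** * Operator norm and quadratic forms *)

Section OperatorNorm.
Variables (R : realType).
Local Notation C := R[i].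
Local Notation normc := (@Normc.normc R).

Lemma normc_ge0 (z : C) : 0 <= normc z.
Proof. by case: z => x y; rewrite sqrtr_ge0. Qed.

Lemma ler_normc_sum (J : finType) (F : J -> C) (G : J -> R) :
  (forall i, normc (F i) <= G i) -> normc (\sum_i F i) <= \sum_i G i.
Proof.
move=> FG; apply: (big_ind2 (fun x y => normc x <= y)) => //.
  by rewrite Normc.normc0.
by move=> x1 x2 y1 y2 h1 h2; rewrite (le_trans (le_normcD _ _)) // lerD.
Qed.

Lemma normc_le_l2norm m (v : 'cV[C]_m) i : normc (v i 0) <= l2norm v.
Proof.
rewrite /l2norm -[leLHS](ger0_norm (normc_ge0 _)) -sqrtr_sqr ler_wsqrtr //.
by rewrite (bigD1 i) //= lerDl sumr_ge0 // => j _; rewrite sqr_ge0.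
Qed.

Lemma normc_le_opnorm m (a : 'M[C]_m) i j : normc (a i j) <= opnorm a.
Proof.
have aE : (a *m delta_mx j (0 : 'I_1)) i 0 = a i j by rewrite -colE mxE.
rewrite -aE; apply: (le_trans (normc_le_l2norm _ _)).
apply: ub_le_sup; last first.
  exists (delta_mx j 0) => //=; rewrite /l2norm (bigD1 j) //= big1 ?addr0.
    rewrite mxE !eqxx /= (_ : Num.sqrt _ ^+ 2 = 1) ?sqrtr1 //.
    by rewrite !expr0n addr0 expr1n sqrtr1 expr1n.
  move=> l /negPf lj; rewrite mxE lj /=.
  by rewrite !expr0n addr0 sqrtr0 expr0n.
(* The supremum dominates its set only if the latter is bounded; sums of the entries along the rows
   give a bound. *)
exists (Num.sqrt (\sum_i (\sum_j normc (a i j)) ^+ 2)) => _ [v v1 <-].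
rewrite /l2norm ler_wsqrtr //; apply: ler_sum => l _.
rewrite lerXn2r ?nnegrE ?normc_ge0 ?sumr_ge0 // => [? _|].
  exact: normc_ge0.
rewrite mxE; apply: ler_normc_sum => p; rewrite Normc.normcM.
by rewrite ler_piMr ?normc_ge0 // (le_trans (normc_le_l2norm _ _)).
Qed.

Lemma normc_Re (z : C) : `|complex.Re z| <= normc z.
Proof.
by case: z => x y /=; rewrite -sqrtr_sqr ler_wsqrtr // lerDl sqr_ge0.
Qed.

(** A crude estimate, entry by entry; the dimensional factor is harmless because the approximations
    it is applied to are arbitrarily fine. *)
Lemma qform_opnorm m (c : 'M[C]_m) (v : 'rV[C]_m) :
  `|qform c v| <= opnorm c * (m * m)%:R * sqnorm v.
Proof.
have vle i j : normc (v 0 i) * normc (v 0 j) <= sqnorm v.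
  have sq l : normc (v 0 l) ^+ 2 <= sqnorm v.
    rewrite sqnormE (bigD1 l) //= lerDl sumr_ge0 // => ? _; exact: sqr_ge0.
  move: (sq i) (sq j); move: (normc _) (normc _) (sqnorm v) => x y s; clear.
  by have := sqr_ge0 (x - y); nra.
apply: (le_trans (normc_Re _)); rewrite mxE.
have -> : opnorm c * (m * m)%:R * sqnorm v =
    \sum_(i < m) \sum_(j < m) opnorm c * sqnorm v.
  by rewrite !sumr_const !card_ord -mulrnA -[RHS]mulr_natr mulrAC.
apply: ler_normc_sum => i; rewrite mxE mulr_suml; apply: ler_normc_sum => j.
rewrite !mxE !Normc.normcM.
have -> : normc ((v 0 i)^*%R) = normc (v 0 i).
  by case: (v 0 i) => x y /=; rewrite sqrrN.
rewrite mulrAC [leRHS]mulrC; apply: ler_pM; rewrite ?mulr_ge0 ?normc_ge0 //.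
exact: normc_le_opnorm.
Qed.

End OperatorNorm.

(** * Step functions and continuous non-decreasing functions on finite sets *)

Section StepFunctions.
Variable R : realType.

(* On a finite set the identity is a constant plus a nonnegative combination of
   step functions. *)
Lemma step_ind (P : (R -> R) -> Prop) (s : seq R) :
  (forall r, P (fun=> r)) ->
  (forall f g, P f -> P g -> P (fun x => f x + g x)) ->
  (forall r t, 0 <= r -> P (fun x => r * step true t x)) ->
  exists2 g, P g & {in s, g =1 id}.
Proof.
move=> Pc PD PS.
(* The list decreases from its head [m]. Requiring [g] to be constant from [m] on is what lets a
   larger value be added in front: one step at that value, of height the gap, corrects [g] there and
   changes nothing below. *)
have sorted_case m u : path (fun x y => y <= x) m u ->
    exists g, [/\ P g, {in m :: u, g =1 id} & forall x, m <= x -> g x = m].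
  elim: u m => [|m' u IH] m.
    by exists (fun=> m); split=> // x; rewrite inE => /eqP ->.
  move=> /andP[m'm mu]; have [g [Pg gid gm]] := IH m' mu.
  exists (fun x => g x + (m - m') * step true m x); split.
  - by apply: PD => //; apply: PS; rewrite subr_ge0.
  - move=> x; rewrite inE => /orP[/eqP ->|xu].
      by rewrite gm // /step lexx mulr1 addrC subrK.
    have xm' : x <= m'.
      move: xu; rewrite inE => /orP[/eqP -> //|xu].
      have tr : transitive (fun x y : R => y <= x).
        by move=> ? ? ? h1 h2; apply: le_trans h1.
      by have /allP/(_ x xu) := order_path_min tr mu.
    rewrite gid // /step; case: leP => [mx|_]; last by rewrite mulr0 addr0.
    have -> : m = m' by apply/eqP; rewrite eq_le m'm (le_trans mx).
    by rewrite subrr mul0r addr0.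
  - move=> x mx; rewrite gm ?(le_trans m'm) // /step mx mulr1.
    by rewrite addrC subrK.
pose u := sort (fun x y => y <= x) s.
have su : sorted (fun x y : R => y <= x) u.
  by apply: sort_sorted => x y; rewrite orbC le_total.
have mem x : (x \in u) = (x \in s) by rewrite mem_sort.
case: u su mem => [|m u] su mem; first by exists (fun=> 0) => // x; rewrite -mem.
have [g [Pg gid _]] := sorted_case m u su.
by exists g => // x; rewrite -mem; apply: gid.
Qed.

(** The value at [t] is 1 or 0 according to [c], as for the closed and the open step. *)
Definition ramp (K t : R) (c : bool) (s : R) : R :=
  Num.max 0 (Num.min 1 (K * (s - t) + c%:R)).

Lemma ramp_continuous K t c : continuous (ramp K t c).
Proof.
move=> s.
apply: (@continuous_max _ _ (fun=> 0) (fun s => Num.min 1 (K * (s - t) + c%:R))).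
  exact: cst_continuous.
apply: (@continuous_min _ _ (fun=> 1) (fun s => K * (s - t) + c%:R)).
  exact: cst_continuous.
apply: (@continuousD _ _ _ (fun s => K * (s - t)) (fun=> c%:R)); last first.
  exact: cst_continuous.
apply: (@continuousM _ _ (fun=> K) (fun s => s - t)); first exact: cst_continuous.
apply: (@continuousB _ _ _ (fun s => s) (fun=> t)); last exact: cst_continuous.
exact: cvg_id.
Qed.

Lemma ramp_homo K t c : 0 <= K -> {homo ramp K t c : x y / x <= y}.
Proof.
move=> K0 x y xy; rewrite /ramp.
have : K * (x - t) + c%:R <= K * (y - t) + c%:R.
  by rewrite lerD2r ler_wpM2l // lerD2r.
move: (K * (x - t) + c%:R) (K * (y - t) + c%:R) => u v uv.
by rewrite ge_max !le_max lexx /= !le_min !ge_min lexx uv !orbT.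
Qed.

(** Once [K * |s - t|] is at least 1, the affine function lies outside the open unit interval on the
    correct side, whether 0 or 1 is added to it, and is clamped. *)
Lemma ramp_step K t c s : 0 <= K -> (s != t -> 1 <= K * `|s - t|) ->
  ramp K t c s = step c t s.
Proof.
move=> K0; rewrite /ramp /step.
have [->|st] := eqVneq s t.
  rewrite subrr mulr0 add0r lexx ltxx.
  by case: c => _; rewrite ?minxx ?min_r ?max_r ?maxxx.
move=> /(_ isT); case: (ltgtP s t) st => // h _.
  rewrite ltr0_norm ?subr_lt0 // mulrN => h1.
  have -> : (if c then false else false) = false by case: c.
  by rewrite max_l // ge_min; apply/orP; right; case: (c) => /=; lra.
rewrite gtr0_norm ?subr_gt0 // => h1.
have -> : (if c then true else true) = true by case: c.
by rewrite min_l ?max_r //; case: (c) => /=; lra.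
Qed.

Lemma ramp_uniform (s : seq R) t :
  exists2 K, 0 <= K & {in s, forall x, x != t -> 1 <= K * `|x - t|}.
Proof.
(* The sum dominates the inverse distance of each point other than [t]; a point equal to [t]
   contributes the inverse of 0, which is 0. *)
exists (\sum_(x <- s) `|x - t|^-1); first by rewrite sumr_ge0 // => x _; rewrite invr_ge0.
move=> x xs xt; have xt0 : 0 < `|x - t| by rewrite normr_gt0 subr_eq0.
rewrite -ler_pdivrMr // div1r (big_rem x) //= lerDl.
by rewrite sumr_ge0 // => y _; rewrite invr_ge0.
Qed.

End StepFunctions.

(** * Comparison of projections by rank, range and kernel *)

Section ProjectionRank.
Variables (R : realType) (n : nat).
Local Notation C := R[i].
Implicit Types (p q : 'M[C]_n) (v : 'rV[C]_n).

(** Multiplication by [q] is injective on the range of [p]. *)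
Lemma proj_rank_le p q : is_proj p ->
  (forall v, v *m p = v -> v *m q = 0 -> v = 0) -> (\rank p <= \rank q)%N.
Proof.
move=> [_ pp] h; rewrite -(mxrank_mul_ker p q).
have -> : (p :&: kermx q)%MS = 0.
  apply/row_matrixP => i; rewrite row0; apply: h.
    have /submxP[D ->] : (row i (p :&: kermx q)%MS <= p)%MS.
      by rewrite (submx_trans (row_sub _ _)) ?capmxSl.
    by rewrite -mulmxA pp.
  by apply/sub_kermxP; rewrite (submx_trans (row_sub _ _)) ?capmxSr.
by rewrite mxrank0 addn0 mxrankM_maxr.
Qed.

Lemma proj_fix_rank p q : is_proj p -> is_proj q ->
  (forall v, v *m p = v -> v *m q = v) -> (\rank q <= \rank p)%N -> p = q.
Proof.
move=> pP qP pq rk; apply: proj_eq => // v vq.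
have [_ pp] := pP.
have E1 : p *m q = p.
  by apply/row_matrixP => i; rewrite row_mul pq // -row_mul pp.
have sub : (p <= q)%MS by rewrite -E1 submxMl.
have /submxP[D qE] : (q <= p)%MS by rewrite -(geq_leqif (mxrank_leqif_sup sub)).
by rewrite -vq qE -!mulmxA pp.
Qed.

(** Orthogonal complements reverse the inclusion of kernels: [p = q *m p], whose adjoint is
    [p = p *m q]. *)
Lemma proj_ker_fix p q v : is_proj p -> is_proj q ->
  (forall v, v *m q = 0 -> v *m p = 0) -> v *m p = v -> v *m q = v.
Proof.
move=> [ph pp] [qh qq] qp vp.
have E : p = q *m p.
  apply/row_matrixP => i; rewrite row_mul; apply/eqP; rewrite -subr_eq0.
  have -> : row i p - row i q *m p = row i (1%:M - q) *m p.
    by rewrite -!row_mul mulmxBl mul1mx linearB.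
  by rewrite qp // -row_mul mulmxBl mul1mx qq subrr row0.
have E2 : p *m q = p.
  have := congr1 (fun M : 'M[C]_n => M^t*) E; rewrite trCM ph qh; exact: esym.
by rewrite -vp -mulmxA E2.
Qed.

Lemma proj_neq0 p : is_proj p -> p != 0 -> exists2 v : 'rV[C]_n, v *m p = v & v != 0.
Proof.
move=> [_ pp] p0; case: (pickP (fun i => row i p != 0)) => [i ri|r0].
  by exists (row i p) => //; rewrite -row_mul pp.
case/eqP: p0; apply/row_matrixP => i; rewrite row0; apply/eqP.
by have := r0 i; case: eqP.
Qed.

End ProjectionRank.

(** * Projections of an isocone *)

Section Isocone.
Variables (R : realType) (k : nat) (n : 'I_k -> nat).
Local Notation C := R[i].
Variables (I : set (dsum R n)) (isoI : isocone I).
Implicit Types (a b u e w : dsum R n) (x y z : 'I_k).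
Local Opaque mx_calculus invmx.

Lemma dsum_ext a b : (forall x, a x = b x) -> a = b.
Proof. exact: functional_extensionality_dep. Qed.

Lemma isocone_adj b x : I b -> (b x)^t* = b x.
Proof.
by move=> /(isocone_self_adjoint isoI) h; apply: (congr1 (fun a => a x) h).
Qed.

Lemma isocone_scale b (r : R) : I b -> 0 <= r -> I (fun x => r%:C *: b x).
Proof.
move=> Ib r0.
have -> : (fun x => r%:C *: b x) = calculus (fun s => r * s) b.
  apply: dsum_ext => x; rewrite /calculus mx_calculusZ mx_calculus_id //.
  exact: isocone_adj.
apply: (isocone_calculus isoI) => //; first exact: mulrl_continuous.
by move=> s t st; rewrite ler_wpM2l.
Qed.

Lemma isocone_step b c t : I b -> I (calculus (step c t) b).
Proof.
move=> Ib.
(* One function acts on all components at once, so the slope must suit the eigenvalues of all of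
   them together. *)
pose s := [seq eigenvalues (b x) 0 i | x <- enum 'I_k, i <- enum 'I_(n x)].
have [K K0 Ks] := ramp_uniform s t.
have -> : calculus (step c t) b = calculus (ramp K t c) b.
  apply: dsum_ext => x; apply: eq_mx_calculus => i; rewrite ramp_step // => ne.
  apply: Ks => //; apply/allpairsPdep; exists x, i.
  by rewrite !mem_enum.
apply: (isocone_calculus isoI) => //; first exact: ramp_continuous.
exact: ramp_homo.
Qed.

(** Density of [I - I] in the form used below, with one error bound for all indices and vectors. *)
Lemma isocone_approx a (eps : R) : (forall x, (a x)^t* = a x) -> 0 < eps ->
  exists b b', [/\ I b, I b' &
    forall x v, `|qform (a x - (b x - b' x)) v| <= eps * sqnorm v].
Proof.
(* [N] exceeds every factor [n x * n x] lost in [qform_opnorm]. *)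
move=> ah e0; pose N : R := 1 + (\sum_x n x * n x)%:R.
have N0 : 0 < N by rewrite ltr_wpDr.
have : norm_closure [set dsum_sub b b' | b in I & b' in I] a.
  by rewrite (isocone_dense isoI); apply: dsum_ext.
move=> /(_ (eps / N) (divr_gt0 e0 N0))[_ [b Ib [b' Ib' <-]] nrm].
exists b, b'; split=> // x v; apply: (le_trans (qform_opnorm _ _)).
rewrite ler_wpM2r ?sqnorm_ge0 //.
have on : opnorm (a x - (b x - b' x)) <= eps / N.
  apply: le_trans (ltW nrm).
  exact: (@le_bigmax _ _ _ _ (fun x => opnorm (dsum_sub a (dsum_sub b b') x)) x).
apply: (@le_trans _ _ (eps / N * N)); last by rewrite divfK // gt_eqF.
apply: (le_trans (ler_wpM2r (ler0n _ _) on)); rewrite ler_wpM2l ?divr_ge0 ?ltW //.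
by rewrite ltr_pwDl // ler_nat (bigD1 x) //= leq_addr.
Qed.

Definition proj_in u := I u /\ forall x, is_proj (u x).

Lemma proj_in_step b c t : I b -> proj_in (calculus (step c t) b).
Proof. by move=> Ib; split; [exact: isocone_step | move=> x; exact: step_proj]. Qed.

Lemma proj_in_const (r : bool) : proj_in (fun x => if r then 1%:M else 0).
Proof.
have := isocone_scalar isoI (r%:R); rewrite /dsum_scalar => h; split.
  move: h; congr I; apply: dsum_ext => x.
  by case: (r); apply/matrixP => i j; rewrite !mxE // mul0rn.
by move=> x; case: (r); [exact: is_proj1 | exact: is_proj0].
Qed.

Lemma proj_in_join u e : proj_in u -> proj_in e ->
  exists2 w, proj_in w &
    forall x (v : 'rV_(n x)), v *m w x = 0 <-> v *m u x = 0 /\ v *m e x = 0.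
Proof.
move=> [Iu uP] [Ie eP]; exists (calculus (step false 0) (dsum_add u e)).
  by apply: proj_in_step; apply: (isocone_add isoI).
by move=> x v; apply: proj_join.
Qed.

Lemma proj_in_meet u e : proj_in u -> proj_in e ->
  exists2 w, proj_in w &
    forall x (v : 'rV_(n x)), v *m w x = v <-> v *m u x = v /\ v *m e x = v.
Proof.
move=> [Iu uP] [Ie eP]; exists (calculus (step true 2) (dsum_add u e)).
  by apply: proj_in_step; apply: (isocone_add isoI).
by move=> x v; apply: proj_meet.
Qed.

(** By [step_ind], [b x] is a scalar plus a combination of its spectral projections, which are
    components of projections of [I]. *)
Lemma proj_in_comm x (q : 'M[C]_(n x)) :
  (forall u, proj_in u -> q *m u x = u x *m q) ->
  forall b, I b -> q *m b x = b x *m q.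
Proof.
move=> qC b Ib.
have bh := isocone_adj x Ib.
have [|f g fC gC|r t _|g gC gid] := @step_ind R
  (fun f => q *m mx_calculus f (b x) = mx_calculus f (b x) *m q)
  [seq eigenvalues (b x) 0 i | i <- enum 'I_(n x)].
- by move=> r; rewrite mx_calculus_cst scalar_mxC.
- rewrite (mx_calculusD f g).
  exact: etrans (mulmxDr _ _ _) (etrans (congr2 +%R fC gC) (esym (mulmxDl _ _ _))).
- rewrite mx_calculusZ -scalemxAr -scalemxAl; congr (_ *: _).
  exact: (qC _ (proj_in_step true t Ib)).
rewrite -(mx_calculus_id bh).
rewrite -(@eq_mx_calculus _ _ g id) // => i; apply: gid.
by apply/mapP; exists i => //; rewrite mem_enum.
Qed.

End Isocone.

(** * Consequences of density: irreducibility of each component, and distinction of two indices *)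

Lemma qform_polar (R : realType) (n : nat) (a : 'M[R[i]]_n) (v w : 'rV[R[i]]_n) :
  a^t* = a ->
  qform a (v + w) = qform a v + qform a w + 2 * complex.Re ((v *m a *m w^t*) 0 0).
Proof.
move=> ah; have E : (w *m a *m v^t*) 0 0 = ((v *m a *m w^t*) 0 0)^*%R.
  have -> : w *m a *m v^t* = (v *m a *m w^t*)^t* by rewrite !trCM trmxCK ah mulmxA.
  by rewrite !mxE.
have addE (A B : 'M[R[i]]_1) : (A + B) 0 0 = A 0 0 + B 0 0 by rewrite mxE.
rewrite /qform trCD mulmxDl mulmxDl !mulmxDr !addE !raddfD /= E.
by case: ((v *m a *m w^t*) 0 0) => x y /=; ring.
Qed.

Section IsoconePairs.
Variables (R : realType) (k : nat) (n : 'I_k -> nat).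
Local Notation C := R[i].
Variables (I : set (dsum R n)) (isoI : isocone I).
Implicit Types (a b u e f g w : dsum R n) (x y z : 'I_k).
Local Opaque mx_calculus invmx.

Lemma dfwith_adj x (c : 'M[C]_(n x)) : c^t* = c ->
  forall z, (dfwith (fun z => 0 : 'M[C]_(n z)) x c z)^t* =
            dfwith (fun z => 0 : 'M[C]_(n z)) x c z.
Proof.
move=> ch z; have [<-|xz] := eqVneq x z; first by rewrite dfwithin.
by rewrite dfwithout // trC0.
Qed.

(* If v is in the range and w in the kernel of q, every b in I satisfies
   v b w^* = 0, and so does every self-adjoint element by density. *)
Lemma isocone_commutant x (q : 'M[C]_(n x)) : is_proj q ->
  (forall b, I b -> q *m b x = b x *m q) -> q = 0 \/ q = 1%:M.
Proof.
move=> qP qC.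
have [->|q0] := eqVneq q 0; first by left.
have [->|q1] := eqVneq q 1%:M; first by right.
exfalso.
have [v vq v0] := proj_neq0 qP q0.
have q1' : 1%:M - q != 0 by rewrite subr_eq0 eq_sym.
have [w wC w0] := proj_neq0 (is_projC qP) q1'.
have wq : w *m q = 0 by rewrite -wC mulmxBr mulmx1 mulmx_projC.
have vw : v *m w^t* = 0.
  by rewrite -vq -mulmxA -[q]qP.1 -trCM wq trC0 mulmx0.
have wv : w *m v^t* = 0.
  by rewrite -[w]trmxCK -trCM vw trC0.
(* The form of [c] vanishes at [v] and at [w], but its cross term is [sqnorm v * sqnorm w], which is
   positive. *)
pose c := v^t* *m w + w^t* *m v.
have ch : c^t* = c by rewrite /c trCD !trCM !trmxCK addrC.
have cv : qform c v = 0.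
  rewrite /qform /c mulmxDr mulmxDl !mulmxA -[_ *m w *m v^t*]mulmxA wv vw.
  by rewrite !mul0mx mulmx0 addr0 mxE.
have cw : qform c w = 0.
  rewrite /qform /c mulmxDr mulmxDl !mulmxA -[_ *m v *m w^t*]mulmxA wv vw.
  by rewrite !mul0mx mulmx0 addr0 mxE.
have cvw : complex.Re ((v *m c *m w^t*) 0 0) = sqnorm v * sqnorm w.
  rewrite /c mulmxDr mulmxDl !mulmxA vw !mul0mx addr0 -mulmxA mxE big_ord1.
  have re (u : 'rV[C]_(n x)) : (u *m u^t*) 0 0 = (sqnorm u)%:C.
    rewrite mxE sqnormE rmorph_sum; apply: eq_bigr => i _.
    rewrite !mxE -normc_sqE; case: (u 0 i) => p r.
    by apply/eqP; rewrite eq_complex /= eqxx /=; apply/eqP; ring.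
  by rewrite !re -rmorphM.
have g0 : 0 < sqnorm v * sqnorm w by rewrite mulr_gt0 ?sqnorm_gt0.
(* The forms of elements of [I] are additive on [v + w], while that of [c] fails to be so by
   [2 * sqnorm v * sqnorm w]. The errors at [v + w], [v] and [w] add up to at most [eps * K], which
   is less than [sqnorm v * sqnorm w]. *)
pose K := sqnorm (v + w) + sqnorm v + sqnorm w.
have K0 : 0 <= K by rewrite !addr_ge0 ?sqnorm_ge0.
have e0 : 0 < sqnorm v * sqnorm w / (K + 1) by rewrite divr_gt0 // ltr_wpDl.
have [b [b' [Ib Ib' approx]]] := isocone_approx isoI (dfwith_adj ch) e0.
have {approx} := approx x; rewrite dfwithin => approx.
have bC g : I g -> complex.Re ((v *m g x *m w^t*) 0 0) = 0.
  move=> Ig; have -> : v *m g x *m w^t* = 0; last by rewrite mxE.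
  by rewrite -vq -(mulmxA v) qC // mulmxA -mulmxA -[q]qP.1 -trCM wq trC0 mulmx0.
have polar g : I g -> qform (g x) (v + w) = qform (g x) v + qform (g x) w.
  by move=> Ig; rewrite qform_polar ?(isocone_adj isoI) // bC // mulr0 addr0.
have cvwE := qform_polar v w ch; rewrite cv cw cvw in cvwE.
have := approx (v + w); have := approx v; have := approx w.
rewrite !qformB (polar b) // (polar b') // cvwE cv cw.
have : sqnorm v * sqnorm w / (K + 1) * (K + 1) = sqnorm v * sqnorm w.
  by rewrite divfK // gt_eqF // ltr_wpDl.
rewrite !ler_norml; move: e0; rewrite -/K; set eps := _ / _.
have : K = sqnorm (v + w) + sqnorm v + sqnorm w by [].
move: K eps g0 {approx cvwE cv cw cvw K0 polar bC} => K eps.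
move: (qform (b x) v) (qform (b x) w) (qform (b' x) v) (qform (b' x) w).
set g := sqnorm v * sqnorm w; move: g (sqnorm (v + w)) (sqnorm v) (sqnorm w).
clear; move=> g svw sv sw p1 p2 p3 p4 g0 -> e0 E h1 h2 h3.
have {}E : eps * svw + eps * sv + eps * sw + eps = g by rewrite -E; ring.
move: (eps * svw) (eps * sv) (eps * sw) E h1 h2 h3 => r1 r2 r3 E.
by move=> /andP[? ?] /andP[? ?] /andP[? ?]; lra.
Qed.

(* Otherwise b - b' could not be close to 0 at x and to 1 at y. *)
Lemma isocone_bounds_differ x y : x != y ->
  (forall b t, I b -> (forall v, qform (b x) v <= t * sqnorm v) <->
                      (forall v, qform (b y) v <= t * sqnorm v)) -> (0 < n y)%N -> False.
Proof.
move=> xy H ny.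
have h0 : (1%:M : 'M[C]_(n y))^t* = 1%:M by exact: trC1.
(* With error 1/4 and [T] the maximum of the spectrum of [b y]: [b' y] is at most [T - 3/4], hence
   so is [b' x]; then [b x] is at most [T - 1/2], hence so is [b y], against the choice of [T]. *)
have e0 : 0 < 4^-1 :> R by rewrite invr_gt0.
have [b [b' [Ib Ib' approx]]] := isocone_approx isoI (dfwith_adj h0) e0.
have ay := approx y; rewrite dfwithin in ay.
have ax := approx x; rewrite dfwithout 1?eq_sym // in ax.
have byh := isocone_adj isoI y Ib.
have [T b1 Tmin] : exists2 T, forall v, qform (b y) v <= T * sqnorm v &
    forall t, (forall v, qform (b y) v <= t * sqnorm v) -> T <= t.
  exists (max_spectrum (b y)); first exact/(max_spectrum_le ny _ byh).
  by move=> t /(max_spectrum_le ny _ byh).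
have b2 : forall v, qform (b' y) v <= (T - 3 / 4) * sqnorm v.
  move=> v; have := ay v; have := b1 v; rewrite !qformB -/(sqnorm v) ler_norml.
  move: (qform (b y) v) (qform (b' y) v) (sqnorm v) => p q s; clear.
  by move=> ? /andP[? ?]; lra.
have b3 : forall v, qform (b x) v <= (T - 1 / 2) * sqnorm v.
  move=> v; have := ax v; have := (H _ _ Ib').2 b2 v.
  rewrite !qformB qform0 ler_norml.
  move: (qform (b x) v) (qform (b' x) v) (sqnorm v) => p q s; clear.
  by move=> ? /andP[? ?]; lra.
have := Tmin _ ((H _ _ Ib).1 b3).
by rewrite lerDl oppr_ge0 leNgt divr_gt0.
Qed.

End IsoconePairs.

(** * Extremal projections separating two indices *)

Section Separation.
Variables (R : realType) (k : nat) (n : 'I_k -> nat).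
Local Notation C := R[i].
Variables (I : set (dsum R n)) (isoI : isocone I).
Implicit Types (u e : dsum R n) (x y z : 'I_k).
Local Opaque mx_calculus invmx.
Local Notation L := (proj_in I).

Lemma cut0 m (t : R) (a : 'M[C]_m) :
  (forall v, qform a v <= t * sqnorm v) -> is_cut false t a 0.
Proof.
move=> h; split=> [||v|v _ _]; first exact: is_proj0.
- by rewrite mul0mx mulmx0.
- by rewrite mulmx0 => <-; rewrite eqxx.
- exact: h.
Qed.

Lemma cut_le m (t : R) (a : 'M[C]_m) v : a^t* = a ->
  v *m mx_calculus (step false t) a = 0 -> qform a v <= t * sqnorm v.
Proof.
move=> ah v0; have [_ _ _ h] := step_cut false t ah.
have [->|nz] := eqVneq v 0; last exact: h.
by rewrite /sqnorm /qform !mul0mx mxE mulr0.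
Qed.

Lemma cut_eq0 m (t : R) (a : 'M[C]_m) : a^t* = a ->
  mx_calculus (step false t) a = 0 <-> forall v, qform a v <= t * sqnorm v.
Proof.
move=> ah; split=> [E v|h]; first by apply: cut_le => //; rewrite E mulmx0.
exact: cut_unique ah (cut0 h).
Qed.

(* With e of maximal rank at x among the projections of I vanishing at y, the
   spectral projection of N e + g above T still vanishes at y and has at least
   the rank of e at x, so that it equals e at x, and e commutes with g. *)
Lemma isocone_separate_max x y u : L u -> u x != 0 -> u y = 0 ->
  exists2 e, L e & e x = 1%:M /\ e y = 0.
Proof.
move=> Lu ux uy.
pose P (r : nat) := `[< exists2 e, L e & e y = 0 /\ \rank (e x) = r >].
have exP : exists r, P r by exists (\rank (u x)); apply/asboolP; exists u.
have ubP r : P r -> (r <= n x)%N.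
  by move=> /asboolP[e _ [_ <-]]; exact: rank_leq_row.
case: (ex_maxnP exP ubP) => r /asboolP[e Le [ey er]] max_r.
have [Ie eP] := Le.
suff comm g : I g -> e x *m g x = g x *m e x.
  have [e0|e1] := isocone_commutant isoI (eP x) comm; last by exists e.
  have : (\rank (u x) <= r)%N by apply: max_r; apply/asboolP; exists u.
  by rewrite -er e0 mxrank0 leqn0 mxrank_eq0 (negbTE ux).
move=> Ig.
have gxh := isocone_adj isoI x Ig; have gyh := isocone_adj isoI y Ig.
have [T1 T10 gx] := selfadj_bound gxh; have [T2 T20 gy] := selfadj_bound gyh.
(* At [y] only [g] remains, and it is at most [T2 <= T]. On the range of [e x] the form of [N e + g]
   is at least [(N - T1) * sqnorm v], that is [(T + 1) * sqnorm v], so no nonzero vector there is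
   killed by [w x]. *)
pose T := T1 + T2; pose N := T + T1 + 1.
have N0 : 0 <= N by rewrite !addr_ge0.
pose b : dsum R n := dsum_add (fun z => N%:C *: e z) g.
have Ib : I b by apply: (isocone_add isoI) => //; exact: isocone_scale.
have Lw := proj_in_step isoI false T Ib.
set w := calculus _ b in Lw; have [Iw wP] := Lw.
have wy : w y = 0.
  apply/cut_eq0; first exact: isocone_adj Ib.
  move=> v; rewrite /b /dsum_add ey scaler0 add0r.
  have /andP[_ h] := gy v; apply: (le_trans h).
  by rewrite ler_wpM2r ?sqnorm_ge0 // lerDr.
have rk_ew : (\rank (e x) <= \rank (w x))%N.
  apply: proj_rank_le => // v ve vw.
  have := cut_le (isocone_adj isoI x Ib) vw.
  rewrite /b /dsum_add qformD qformZ (qform_fix (eP x) ve).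
  have /andP[h _] := gx v; move=> h'; apply/eqP.
  rewrite -sqnorm_eq0 eq_le sqnorm_ge0 andbT.
  move: h h' T10 T20; rewrite /N /T; move: (qform (g x) v) (sqnorm v) => q s.
  by clear; nra.
(* The join still vanishes at [y], so by maximality it does not exceed [e] at [x]; this puts the
   range of [w x] inside that of [e x]. *)
have [j Lj jP] := proj_in_join isoI Le Lw.
have jy : j y = 0.
  apply/row_matrixP => i; rewrite row0 rowE; apply/(jP y).
  by rewrite ey wy !mulmx0.
have ej (v : 'rV_(n x)) : v *m e x = v -> v *m j x = v.
  by move=> ve; apply: (proj_ker_fix (eP x) (Lj.2 x) _ ve) => v' /(jP x)[].
have wj (v : 'rV_(n x)) : v *m w x = v -> v *m j x = v.
  by move=> vw; apply: (proj_ker_fix (wP x) (Lj.2 x) _ vw) => v' /(jP x)[].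
have rj : (\rank (j x) <= \rank (e x))%N.
  by rewrite er; apply: max_r; apply/asboolP; exists j.
have E := proj_fix_rank (eP x) (Lj.2 x) ej rj.
rewrite -E in wj.
have we := proj_fix_rank (wP x) (eP x) wj rk_ew.
have [_ wb _ _] := step_cut false T (isocone_adj isoI x Ib).
have {}wb : w x *m b x = b x *m w x by exact: wb.
rewrite we /b /dsum_add mulmxDr mulmxDl -scalemxAr -scalemxAl in wb.
exact: addrI wb.
Qed.

Lemma proj_neq1_rank m (p : 'M[C]_m) : is_proj p -> p <> 1%:M -> (\rank p < m)%N.
Proof.
move=> pP p1; rewrite ltnNge; apply/negP => rk; apply: p1.
apply: (proj_fix_rank pP (is_proj1 _ _)) => [v _|]; first by rewrite mulmx1.
by rewrite mxrank1.
Qed.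

(* With q of minimal rank at y among the projections of I that agree with r at x,
   the spectral projection of 4 q + (0, g) above 2 agrees with r at x and has at
   most the rank of q at y; its meet with q shows that it equals q at y, and q
   commutes with g. *)
Lemma isocone_separate_min x y (f r : dsum R n) : L f -> f x = 0 -> f y = 1%:M ->
  L r -> r y <> 1%:M -> exists2 e, L e & e x = r x /\ e y = 0.
Proof.
move=> Lf fx fy Lr ry.
pose P m := `[< exists2 e, L e & e x = r x /\ \rank (e y) = m >].
have exP : exists m, P m by exists (\rank (r y)); apply/asboolP; exists r.
case: (ex_minnP exP) => m /asboolP[q Lq [qx qm]] min_m.
have [Iq qP] := Lq.
suff comm g : I g -> q y *m g y = g y *m q y.
  have [q0|q1] := isocone_commutant isoI (qP y) comm; first by exists q.
  have := proj_neq1_rank (Lr.2 y) ry; rewrite ltnNge => /negP[].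
  have my : m = n y by rewrite -qm q1 mxrank1.
  by apply: (leq_trans (eq_leq (esym my))); apply: min_m; apply/asboolP; exists r.
apply: (proj_in_comm isoI) => {}g Lg; have [Ig gP] := Lg.
have gle z (v : 'rV_(n z)) := qform_proj_le v (gP z).
(* Adding [f] and cutting above 1 erases [g] at [x], where [g <= 1], and keeps it at [y], where
   [g + 1 > 1] exactly on the range of [g]. *)
have Igf : I (dsum_add g f) by apply: (isocone_add isoI) => //; case: Lf.
have Lh := proj_in_step isoI false 1 Igf.
set h := calculus _ _ in Lh; have [Ih hP] := Lh.
have hx : h x = 0.
  apply/cut_eq0; first exact: isocone_adj Igf.
  by move=> v; rewrite /dsum_add fx addr0 mul1r.
have hy : h y = g y.
  apply: cut_unique; first exact: isocone_adj Igf.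
  rewrite /dsum_add fy; split=> [||v vg v0|v vg v0]; first exact: gP.
  - by rewrite mulmxDr mulmxDl mulmx1 mul1mx.
  - rewrite qformD (qform_fix (gP y) vg) -/(sqnorm v) mul1r ltrDl.
    by rewrite sqnorm_gt0.
  - by rewrite qformD (qform_ker (gP y) vg) -/(sqnorm v) mul1r add0r.
(* The threshold 2 lies below the coefficient 4, so that [q] survives at [x], and above the bound 1
   of [h], so that at [y] no nonzero vector of the range of [u] is in the kernel of [q]. *)
pose b : dsum R n := dsum_add (fun z => 4%:C *: q z) h.
have Ib : I b by apply: (isocone_add isoI) => //; apply: isocone_scale.
have Lu := proj_in_step isoI false 2 Ib.
set u := calculus _ b in Lu; have [Iu uP] := Lu.
have ux : u x = q x.
  apply: cut_unique; first exact: isocone_adj Ib.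
  rewrite /b /dsum_add hx addr0; split=> [||v vq v0|v vq v0]; first exact: qP.
  - by rewrite -scalemxAr -scalemxAl.
  - by rewrite qformZ (qform_fix (qP x) vq) ltr_pM2r ?sqnorm_gt0 // ltr_nat.
  - by rewrite qformZ (qform_ker (qP x) vq) mulr0 mulr_ge0 ?sqnorm_ge0.
have rk_uq : (\rank (u y) <= \rank (q y))%N.
  apply: proj_rank_le => // v vu vq; apply/eqP/negPn/negP => v0.
  have [_ _ cut _] := step_cut false 2 (isocone_adj isoI y Ib).
  have := cut v vu v0; apply/negP; rewrite -leNgt /b /dsum_add hy qformD qformZ.
  rewrite (qform_ker (qP y) vq) mulr0 add0r; apply: (le_trans (gle _ _)).
  by rewrite ler_peMl ?sqnorm_ge0 // ler1n.
(* The meet also agrees with [r] at [x] and lies below [q], so minimality forces it to equal [q] at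
   [y]; thus [q y] lies below [u y]. *)
have [w Lw wM] := proj_in_meet isoI Lq Lu; have [Iw wP] := Lw.
have wx : w x = r x.
  rewrite -qx; apply: proj_eq => // v; first by move/(wM x) => [].
  by move=> vq; apply/(wM x); rewrite ux.
have wq (v : 'rV_(n y)) : v *m w y = v -> v *m q y = v by move/(wM y) => [].
have rk_qw : (\rank (q y) <= \rank (w y))%N.
  by rewrite qm; apply: min_m; apply/asboolP; exists w.
have E := proj_fix_rank (wP y) (qP y) wq rk_qw.
have qu : q y = u y.
  apply: (proj_fix_rank (qP y) (uP y)) => // v; rewrite -E.
  by move/(wM y) => [].
have [_ ub _ _] := step_cut false 2 (isocone_adj isoI y Ib).
have {}ub : u y *m b y = b y *m u y by exact: ub.
rewrite -qu /b /dsum_add hy mulmxDr mulmxDl -scalemxAr -scalemxAl in ub.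
exact: addrI ub.
Qed.

End Separation.

(** * The order and the lexicographic sum *)

Section LexStructure.
Variables (R : realType) (k : nat) (n : 'I_k -> nat).
Hypothesis n_gt0 : forall x, (0 < n x)%N.
Local Notation C := R[i].
Variables (I : set (dsum R n)) (isoI : isocone I).
Implicit Types (x y z : 'I_k).
Local Opaque mx_calculus invmx.
Local Notation L := (proj_in I).

Lemma max_spectrum_form (b : dsum R n) x (v : 'rV_(n x)) : I b ->
  qform (b x) v <= max_spectrum (b x) * sqnorm v.
Proof.
move=> Ib; have bh := isocone_adj isoI x Ib.
by have /(max_spectrum_le (n_gt0 x) _ bh) := lexx (max_spectrum (b x)).
Qed.

Lemma min_spectrum_form (b : dsum R n) x (v : 'rV_(n x)) : I b ->
  min_spectrum (b x) * sqnorm v <= qform (b x) v.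
Proof.
move=> Ib; have bh := isocone_adj isoI x Ib.
by have /(min_spectrum_ge (n_gt0 x) _ bh) := lexx (min_spectrum (b x)).
Qed.

Lemma min_le_max_spectrum (b : dsum R n) x : I b ->
  min_spectrum (b x) <= max_spectrum (b x).
Proof.
move=> Ib; pose v : 'rV[C]_(n x) := const_mx 1.
have v0 : 0 < sqnorm v.
  rewrite sqnorm_gt0; apply/eqP => /rowP/(_ (Ordinal (n_gt0 x))) /eqP.
  by rewrite !mxE oner_eq0.
rewrite -(ler_pM2r v0).
exact: le_trans (min_spectrum_form v Ib) (max_spectrum_form v Ib).
Qed.

(** At the midpoint level [t], the spectral projection [r] of [b] is nonzero at [x] and not the
    identity at [y]. Either some upper bound holds at [y] only, and a maximal projection suffices;
    or some upper bound holds at [x] only, and the resulting projection serves to clear [r] at [y]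
    while keeping it at [x]. By density one of the two occurs. *)
Lemma isocone_separate x y (b : dsum R n) : x != y -> I b ->
  min_spectrum (b y) < max_spectrum (b x) ->
  exists2 e, L e & e x = 1%:M /\ e y = 0.
Proof.
move=> xy Ib /midf_lt[]; set t := _ / 2 => ty tx.
pose r := calculus (step false t) b.
have Lr : L r by exact: proj_in_step.
have bxh := isocone_adj isoI x Ib; have byh := isocone_adj isoI y Ib.
have rx : r x != 0.
  apply/eqP => /(cut_eq0 _ bxh)/(max_spectrum_le (n_gt0 x) _ bxh).
  by rewrite leNgt tx.
have ry : r y <> 1%:M.
  move=> ry; have [_ _ h _] := step_cut false t byh.
  have : t <= min_spectrum (b y).
    apply/(min_spectrum_ge (n_gt0 y) _ byh) => v.
    have [->|v0] := eqVneq v 0.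
      by rewrite /sqnorm /qform !mul0mx mxE mulr0.
    apply/ltW/h => //; rewrite -[RHS]mulmx1; congr (v *m _); exact: ry.
  by rewrite leNgt ty.
have above z z' : (exists c s, [/\ I c,
      forall v, qform (c z') v <= s * sqnorm v &
      ~ forall v, qform (c z) v <= s * sqnorm v]) ->
    exists2 e, L e & e z = 1%:M /\ e z' = 0.
  move=> [c [s [Ic cz' cz]]].
  apply: (isocone_separate_max isoI (proj_in_step isoI false s Ic)).
    by apply/eqP => /(cut_eq0 _ (isocone_adj isoI z Ic)).
  exact/(cut_eq0 _ (isocone_adj isoI z' Ic)).
have [/above //|nxy] := pselect (exists c s, [/\ I c,
  forall v, qform (c y) v <= s * sqnorm v &
  ~ forall v, qform (c x) v <= s * sqnorm v]).
have [/above[f Lf [fy fx]]|nyx] := pselect (exists c s, [/\ I c,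
  forall v, qform (c x) v <= s * sqnorm v &
  ~ forall v, qform (c y) v <= s * sqnorm v]).
  have [e Le [ex ey]] := isocone_separate_min isoI Lf fx fy Lr ry.
  by apply: (isocone_separate_max isoI Le _ ey); rewrite ex.
exfalso; apply: (isocone_bounds_differ isoI xy _ (n_gt0 y)) => c s Ic.
by split=> h; apply: contrapT => h'; [apply: nyx | apply: nxy]; exists c, s.
Qed.

(** For each [x] some projection of [I] lies below [p] and equals [p] at [x]; the join of these over
    all [x] is [p]. *)
Lemma proj_in_glue (p : dsum R n) :
  (forall x, exists2 u, L u & u x = p x) ->
  (forall x y, x != y ->
    [\/ p x = 0, p y = 1%:M | exists2 e, L e & e x = 1%:M /\ e y = 0]) ->
  L p.
Proof.
move=> pL sep.
have below x : exists2 q, L q & q x = p x /\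
    forall y (v : 'rV_(n y)), v *m p y = 0 -> v *m q y = 0.
  have [px0|px0] := eqVneq (p x) 0.
    exists (fun=> 0); first exact: (proj_in_const isoI false).
    by split=> // y v _; rewrite mulmx0.
  (* [E] is a meet of separating projections; its meet with [u] is unchanged at [x] and is erased
     wherever [p] is not the identity, hence is below [p]. *)
  have [E LE [Ex Ey]] : exists2 E, L E & E x = 1%:M /\
      forall y, y \in enum 'I_k -> x != y -> p y <> 1%:M -> E y = 0.
    elim: (enum _) => [|y s [E LE [Ex Ey]]].
      by exists (fun=> 1%:M) => //; exact: (proj_in_const isoI true).
    have [xy|] := pselect (x != y /\ p y <> 1%:M); last first.
      move=> nxy; exists E => //; split=> // z; rewrite inE => /orP[/eqP ->|zs].
        by move=> xy py; case: nxy.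
      exact: Ey.
    have [e Le [ex ey]] : exists2 e, L e & e x = 1%:M /\ e y = 0.
      by case: xy => xy py; case: (sep x y xy) => // px; rewrite px eqxx in px0.
    have [w Lw wM] := proj_in_meet isoI LE Le; exists w => //; split.
      apply: proj_eq => [||v _|v _]; [exact: Lw.2|exact: is_proj1|exact: mulmx1|].
      by apply/(wM x); rewrite Ex ex mulmx1.
    have w0 z : E z = 0 \/ e z = 0 -> w z = 0.
      move=> z0; apply: proj_eq => [||v /(wM z)[vE ve]|v].
      - exact: Lw.2.
      - exact: is_proj0.
      - by case: z0 => z0; [rewrite -vE z0|rewrite -ve z0]; rewrite !mulmx0.
      - by rewrite mulmx0 => <-; rewrite mul0mx.
    move=> z; rewrite inE => /orP[/eqP ->|zs] xz pz; apply: w0; first by right.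
    by left; apply: Ey.
  have [u Lu ux] := pL x; have [w Lw wM] := proj_in_meet isoI LE Lu.
  have wx : w x = p x.
    rewrite -ux; apply: proj_eq => [||v /(wM x)[]|v vu] //; [exact: Lw.2|exact: Lu.2|].
    by apply/(wM x); rewrite Ex mulmx1.
  exists w => //; split=> // y v vp; have [xy|xy] := eqVneq x y.
    by move: v vp; rewrite -xy => v vp; rewrite wx.
  have [py|py] := pselect (p y = 1%:M).
    by move: vp; rewrite py mulmx1 => ->; rewrite mul0mx.
  have [vE _] := (wM y (v *m w y)).1 (mulmx_proj v (Lw.2 y)).
  by rewrite -vE Ey ?mulmx0 // mem_enum.
have [w Lw [wp pw]] : exists2 w, L w &
    (forall y (v : 'rV_(n y)), v *m p y = 0 -> v *m w y = 0) /\
    forall x, x \in enum 'I_k -> forall v : 'rV_(n x), v *m w x = 0 -> v *m p x = 0.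
  elim: (enum _) => [|x s [w Lw [wp pw]]].
    exists (fun=> 0); first exact: (proj_in_const isoI false).
    by split=> // y v _; rewrite mulmx0.
  have [q Lq [qx qp]] := below x; have [j Lj jP] := proj_in_join isoI Lw Lq.
  exists j => //; split=> [y v vp|z zs v /(jP z)[vw vq]].
    by apply/(jP y); split; [exact: wp|exact: qp].
  have [xz|xz] := eqVneq z x; last first.
    by apply: pw vw; move: zs; rewrite inE (negbTE xz).
  by move: xz vq {vw} => xz; move: v; rewrite xz => v; rewrite qx.
suff -> : p = w by [].
apply: dsum_ext => x; apply: proj_eq_ker => [||v].
- by have [u Lu <-] := pL x; exact: Lu.2.
- exact: Lw.2.
- by split=> [/wp|] //; apply: pw; rewrite mem_enum.
Qed.

(** If [x] precedes [y], a level above the spectrum of [a x] makes the projection 0 at [x], and any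
    other level is at most [min_spectrum (a y)] and makes it the identity at [y]. The remaining
    pairs are separated inside [I]. *)
Lemma Lex_step (le : rel 'I_k) (a : dsum R n) (t : R) :
  (forall x y, x != y -> ~~ le x y ->
     exists2 b, I b & min_spectrum (b y) < max_spectrum (b x)) ->
  Lex le (fun x => (fun b : dsum R n => b x) @` I) a ->
  L (calculus (step true t) a).
Proof.
move=> nle [aI ale].
have ah x : (a x)^t* = a x by have [b Ib <-] := aI x; exact: isocone_adj Ib.
apply: proj_in_glue => [x|x y xy].
  have [b Ib bx] := aI x; exists (calculus (step true t) b).
    exact: proj_in_step.
  by rewrite /calculus bx.
have [lexy|/(nle x y xy)[b Ib bxy]] := boolP (le x y); last first.
  by apply: Or33; apply: isocone_separate bxy.
have [ax|ax] := ltP (max_spectrum (a x)) t.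
  apply: Or31; apply: cut_unique => //; split=> [||v|v _ v0]; first exact: is_proj0.
  - by rewrite mul0mx mulmx0.
  - by rewrite mulmx0 => <-; rewrite eqxx.
  - have [b Ib bx] := aI x.
    have := max_spectrum_form v Ib; rewrite bx => h; apply: (le_lt_trans h).
    by rewrite ltr_pM2r ?sqnorm_gt0.
apply: Or32; apply: cut_unique => //; split=> [||v _ v0|v]; first exact: is_proj1.
- by rewrite mul1mx mulmx1.
- have [b Ib bx] := aI y.
  have := min_spectrum_form v Ib; rewrite bx; apply: le_trans.
  rewrite ler_wpM2r ?sqnorm_ge0 //; apply: (le_trans ax); exact: ale.
- by rewrite mulmx1 => ->; rewrite eqxx.
Qed.

(** By [step_ind], [a] is a scalar plus a nonnegative combination of the projections treated in
    [Lex_step]. *)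
Lemma Lex_sub_isocone (le : rel 'I_k) :
  (forall x y, x != y -> ~~ le x y ->
     exists2 b, I b & min_spectrum (b y) < max_spectrum (b x)) ->
  Lex le (fun x => (fun b : dsum R n => b x) @` I) `<=` I.
Proof.
move=> nle a aL; have Lstep t := Lex_step t nle aL.
have ah x : (a x)^t* = a x.
  by have [b Ib <-] := aL.1 x; exact: isocone_adj Ib.
have [r|f g fI gI|r t r0|g gI gid] := @step_ind R (fun f => I (calculus f a))
  [seq eigenvalues (a x) 0 i | x <- enum 'I_k, i <- enum 'I_(n x)].
- have := isocone_scalar isoI r; congr I; apply: dsum_ext => x.
  by rewrite /calculus mx_calculus_cst.
- have := isocone_add isoI fI gI; congr I; apply: dsum_ext => x.
  by rewrite /calculus (mx_calculusD f g).
- have := isocone_scale isoI (Lstep t).1 r0; congr I; apply: dsum_ext => x.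
  by rewrite /calculus (mx_calculusZ r (step true t)).
suff <- : calculus g a = a by [].
apply: dsum_ext => x; apply: etrans (mx_calculus_id (ah x)).
apply: eq_mx_calculus => i; apply: gid; apply/allpairsPdep; exists x, i.
by rewrite !mem_enum.
Qed.

End LexStructure.

Theorem theorem11 (R : realType) (k : nat) (n : 'I_k -> nat)
    (k_gt0 : (0 < k)%N) (n_gt0 : forall x : 'I_k, (0 < n x)%N)
    (I : set (dsum R n)) (isoI : isocone I) :
  exists le : rel 'I_k,
    [/\ reflexive le, antisymmetric le & transitive le] /\
    I = Lex le (fun x : 'I_k => (fun a : dsum R n => a x) @` I).
Proof.
pose below x y := forall b, I b -> max_spectrum (b x) <= min_spectrum (b y).
exists (fun x y => `[< x = y \/ below x y >]); split; [split|].
- by move=> x; apply/asboolP; left.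
- move=> x y /andP[/asboolP[//|xy] /asboolP[//|yx]].
  (* If each of two distinct indices were below the other, every [b] in [I] would have the same
     upper bounds at both, which density forbids. *)
  apply: contrapT => /eqP ne.
  apply: (isocone_bounds_differ isoI ne _ (n_gt0 y)) => b t Ib.
  have xh := isocone_adj isoI x Ib; have yh := isocone_adj isoI y Ib.
  rewrite -(max_spectrum_le (n_gt0 x) _ xh) -(max_spectrum_le (n_gt0 y) _ yh).
  have hx := le_trans (xy _ Ib) (min_le_max_spectrum n_gt0 isoI y Ib).
  have hy := le_trans (yx _ Ib) (min_le_max_spectrum n_gt0 isoI x Ib).
  by split; apply: le_trans.
- move=> y x z /asboolP[-> //|xy] /asboolP[<-|yz]; apply/asboolP; right=> // b Ib.
  apply: (le_trans (xy _ Ib)); apply: le_trans (yz _ Ib).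
  exact: (min_le_max_spectrum n_gt0 isoI y Ib).
apply/seteqP; split=> [a Ia|].
  split=> [x|x y /asboolP[->|xy _]]; first by exists a.
    by rewrite eqxx.
  exact: xy.
apply: (Lex_sub_isocone n_gt0 isoI) => x y xy /asboolPn nle.
have : ~ below x y by move=> h; apply: nle; right.
by move=> /existsNP[b /not_implyP[Ib /negP]]; rewrite -ltNge; exists b.
Qed.
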